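(* Let $k$ be a positive integer. Let $(G,\sigma)$ be a $(2k+1)$-unbalanced, $(12k-1)$-edge connected signed graph. Then for every mapping $\beta:V(G)\to\mathbb{Z}_{2k+1}$, the signed graph $(G,\sigma)$ has a $\beta$-orientation.
   Context: A signed graph is a pair $(G,\sigma)$ where $G$ is a graph and $\sigma:E(G)\to\{1,-1\}$; edges with $\sigma(e)=1$ are positive, those with $\sigma(e)=-1$ negative. An orientation $\tau$ of $(G,\sigma)$ orients each positive edge $e=xy$ from one end to the other (if from $x$ to $y$, then $e\in E^+_\tau(x)\cap E^-_\tau(y)$), and labels each negative edge $e=xy$ either as a sink edge, with $e\in E^+_\tau(x)\cap E^+_\tau(y)$, or as a source edge, with $e\in E^-_\tau(x)\cap E^-_\tau(y)$. Write $d^+_\tau(x)=|E^+_\tau(x)|$ and $d^-_\tau(x)=|E^-_\tau(x)|$. Given $\beta:V(G)\to\mathbb{Z}_{2k+1}$, a $\beta$-orientation is an orientation $\tau$ with $d^+_\tau(x)-d^-_\tau(x)\equiv\beta(x)\pmod{2k+1}$ for every vertex $x$. Switching at a vertex $v$ negates the sign of every edge incident to $v$. Two signed graphs on the same underlying graph are equivalent if one is obtained from the other by a sequence of switchings. $(G,\sigma)$ is $(2k+1)$-unbalanced if every signed graph equivalent to it has at least $2k+1$ negative edges. Edge connectivity refers to $G$. *)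

(* Defs.v *)
From mathcomp Require Import all_boot all_order all_algebra.
Set Implicit Arguments. Unset Strict Implicit. Unset Printing Implicit Defensive.
Import GRing.Theory.

(* A signed (multi)graph: finite vertex type V, finite edge type E,
   [ends e] = the two ends of e (loopless: the ends are distinct).
   A signature is [neg : E -> bool], [neg e = true] iff sigma(e) = -1. *)

Definition loopless (V E : finType) (ends : E -> V * V) : Prop :=
  forall e, (ends e).1 != (ends e).2.

Definition incident (V E : finType) (ends : E -> V * V) (x : V) (e : E) : bool :=
  ((ends e).1 == x) || ((ends e).2 == x).

Definition switch (V E : finType) (ends : E -> V * V) (neg : E -> bool) (v : V)
  : E -> bool := fun e => if incident ends v e then ~~ neg e else neg e.

Definition switch_seq (V E : finType) (ends : E -> V * V) (neg : E -> bool)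
  (s : seq V) : E -> bool := foldl (switch ends) neg s.

Definition unbalanced (V E : finType) (ends : E -> V * V) (neg : E -> bool)
  (m : nat) : Prop :=
  forall s : seq V, m <= #|[set e | switch_seq ends neg s e]|.

Definition edge_connected (V E : finType) (ends : E -> V * V) (m : nat) : Prop :=
  forall X : {set V}, X != set0 -> X != setT ->
    m <= #|[set e | ((ends e).1 \in X) != ((ends e).2 \in X)]|.

(* An orientation tau : E -> bool.  For a positive edge e with ends (u,v),
   tau e = true means e is oriented from u to v (e in E^+(u), e in E^-(v)),
   tau e = false means from v to u.  For a negative edge, tau e = true means a
   sink edge (e in E^+ of both ends), tau e = false a source edge (E^- of both). *)
Definition in_Eplus (V E : finType) (ends : E -> V * V) (neg : E -> bool)
  (tau : E -> bool) (x : V) (e : E) : bool :=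
  if neg e then tau e && incident ends x e
  else (tau e && ((ends e).1 == x)) || (~~ tau e && ((ends e).2 == x)).

Definition in_Eminus (V E : finType) (ends : E -> V * V) (neg : E -> bool)
  (tau : E -> bool) (x : V) (e : E) : bool :=
  if neg e then ~~ tau e && incident ends x e
  else (tau e && ((ends e).2 == x)) || (~~ tau e && ((ends e).1 == x)).

Definition dplus (V E : finType) (ends : E -> V * V) (neg : E -> bool)
  (tau : E -> bool) (x : V) : nat := #|[set e | in_Eplus ends neg tau x e]|.

Definition dminus (V E : finType) (ends : E -> V * V) (neg : E -> bool)
  (tau : E -> bool) (x : V) : nat := #|[set e | in_Eminus ends neg tau x e]|.

Definition beta_orientation (V E : finType) (ends : E -> V * V) (neg : E -> bool)
  (n : nat) (beta : V -> 'Z_n) (tau : E -> bool) : Prop :=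
  forall x : V,
    ((dplus ends neg tau x)%:R - (dminus ends neg tau x)%:R : 'Z_n)%R = beta x.

(* Main.v *)
(** Switch to a signature with as few negative edges as possible. Switching a set [X] of vertices exchanges
    the signs across the cut of [X], so at least half of each cut, hence at least [6k] edges, is positive.
    A sink edge contributes 2 and a source edge -2 to the sum of the demands, so the negative edges, being at
    least [2k] in number, can be oriented so that the demands left to the positive edges sum to 0 modulo
    [2k+1]. The positive edges are then oriented by the theorem of Lovasz, Thomassen, Wu and Zhang.

    That theorem is proved for graphs in which a root vertex has all its edges already oriented, under the
    condition that [deg A >= 4p + |dem A|] for each set [A] of vertices avoiding the root, where [|dem A|] is
    the distance from the demand to the multiples of [4p+2], while the root satisfies the opposite inequality.
    If a set with at least two vertices attains equality, contract it, orient, and then orient its inside with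
    the complement contracted into the root. Otherwise deleting or moving an edge can only violate the
    condition at single vertices. A vertex of demand 0 is removed by lifting its edges in pairs. If there
    is none, each demand is positive or negative, and an edge whose orientation can be chosen to bring the
    demands of its ends closer to 0 can be deleted. So all demands have the same sign, say positive, and
    no vertex has an edge oriented to the root. Adding such edges at [x] raises the demand of [x] to [2p+1],
    the farthest from the multiples of [4p+2], whence an edge at [x] can be oriented towards [x] and deleted. *)
Require Import Defs.
From mathcomp Require Import all_boot all_order all_algebra.
From mathcomp Require Import zify ring.
From Stdlib Require Import Classical.
Set Implicit Arguments. Unset Strict Implicit. Unset Printing Implicit Defensive.
Import Order.TTheory GRing.Theory Num.Theory.
Local Open Scope ring_scope.

(** * Distance to the multiples of the modulus *)

(* Prescribing the outdegree minus the indegree modulo [2p + 1] at a vertex of given degree prescribes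
   it modulo [4p + 2], since its parity is that of the degree. *)
Definition modulus (p : nat) : int := 4 * p%:Z + 2.

Definition nrm (p : nat) (z : int) : int :=
  Num.min (z %% modulus p)%Z (modulus p - (z %% modulus p)%Z).

(** The representative of least absolute value is the working form of [nrm]: linear arithmetic then
    replaces [%%] in the later arguments. *)
Lemma nrm_spec p z : exists t j : int,
  [/\ z = t + modulus p * j, nrm p z = `|t| & `|t| <= 2 * p%:Z + 1].
Proof.
have M0 : modulus p != 0 by rewrite /modulus; lia.
have := divz_eq z (modulus p).
have := modz_ge0 z M0.
have : (z %% modulus p)%Z < modulus p by rewrite ltz_pmod // /modulus; lia.
rewrite /nrm; set r := (z %% _)%Z; set q := (z %/ _)%Z => rM r0 zE.
case: (leP r (modulus p - r)) => h.
  exists r, q; rewrite /modulus in h zE rM *; split; lia.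
exists (r - modulus p), (q + 1); rewrite /modulus in h zE rM *; split; lia.
Qed.

(** Two distinct representatives differ by at least the modulus, and the least one is at most half
    of it. *)
Lemma nrm_min p z t j : z = t + modulus p * j -> nrm p z <= `|t|.
Proof.
have [t' [j' [-> -> lt]]] := nrm_spec p z; rewrite /modulus => E.
suff : (j' = j \/ modulus p <= `|t - t'|) by rewrite /modulus; case=> ?; subst; lia.
have {E} : t - t' = modulus p * (j' - j) by rewrite /modulus; lia.
have [->|ne ->] := eqVneq j' j; first by left.
right; rewrite normrM /modulus; have : 1 <= `|j' - j| by lia.
nia.
Qed.

Lemma nrm_add p z c : nrm p (z + c) <= nrm p z + `|c|.
Proof.
have [t [j [zE -> lt]]] := nrm_spec p z.
apply: le_trans (ler_normD t c).
by apply: (@nrm_min _ _ _ j); rewrite zE; lia.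
Qed.

Lemma nrm_period p z j : nrm p (z + modulus p * j) = nrm p z.
Proof.
have [t [i [zE tE lt]]] := nrm_spec p z.
have [t' [i' [zE' tE' lt']]] := nrm_spec p (z + modulus p * j).
apply/eqP; rewrite eq_le {1}tE tE'; apply/andP; split; rewrite -?tE' -?tE.
  rewrite tE; apply: (@nrm_min _ _ _ (i + j)); rewrite zE; lia.
rewrite tE'; apply: (@nrm_min _ _ _ (i' - j)); lia.
Qed.

Lemma nrmN p z : nrm p (- z) = nrm p z.
Proof.
suff le w : nrm p (- w) <= nrm p w by apply/eqP; rewrite eq_le le -{1}(opprK z) le.
have [t [j [zE -> lt]]] := nrm_spec p w.
by rewrite -normrN; apply: (@nrm_min _ _ _ (- j)); rewrite zE; lia.
Qed.

Lemma nrm_le p z : 0 <= nrm p z <= 2 * p%:Z + 1.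
Proof. have [t [j [zE -> lt]]] := nrm_spec p z; lia. Qed.

(** The modulus is even, so neither reduction nor a change of sign affects parity. *)
Lemma nrm_parity p z : exists k : int, z = nrm p z + 2 * k.
Proof.
have [t [j [zE -> lt]]] := nrm_spec p z.
case: (leP 0 t) => h; rewrite /modulus in zE.
  exists ((2 * p%:Z + 1) * j); lia.
exists ((2 * p%:Z + 1) * j + t); lia.
Qed.

Section Weighted.
Variable V : finType.
Implicit Types (w h : V -> V -> int) (b f ep em : V -> int) (S A B : {set V}) (x y u v : V).

(** * Weighted cuts and orientations *)

(* A multigraph on [S] is given by its symmetric edge multiplicities [w]; the diagonal of [w] is
   irrelevant. *)
Definition vol f A : int := \sum_(x in A) f x.

Definition cut w S A : int := \sum_(x in A) \sum_(y in S :\: A) w x y.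

Definition shift f x (c : int) u : int := f u + (if u == x then c else 0).

Definition adjust w x y (c : int) u v : int :=
  w u v + (if (u == x) && (v == y) || (u == y) && (v == x) then c else 0).

Lemma vol_if f x (c : int) A :
  \sum_(u in A) (if u == x then c else 0) = if x \in A then c else 0.
Proof.
rewrite -big_mkcondr /=; case: ifP => xA.
  by rewrite (big_pred1 x) // => u /=; case: (eqVneq u x) => [->|]; rewrite ?xA ?andbF.
by apply: big_pred0 => u; case: (eqVneq u x) => [->|]; rewrite ?xA ?andbF.
Qed.

Lemma vol_shift f x c A : vol (shift f x c) A = vol f A + if x \in A then c else 0.
Proof. by rewrite /vol big_split /= vol_if. Qed.

Lemma vol_ge0 f A : (forall x, 0 <= f x) -> 0 <= vol f A.
Proof. by move=> f0; apply: sumr_ge0. Qed.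

Lemma vol1 f x : vol f [set x] = f x.
Proof. by rewrite /vol big_set1. Qed.

Lemma vol_setD f A S : A \subset S -> vol f S = vol f A + vol f (S :\: A).
Proof. by move=> AS; rewrite /vol (big_setID A) /= (setIidPr AS). Qed.

Lemma sum2_adjust w x y c A B : x != y ->
  \sum_(u in A) \sum_(v in B) adjust w x y c u v =
  \sum_(u in A) \sum_(v in B) w u v
  + (if (x \in A) && (y \in B) then c else 0) + (if (y \in A) && (x \in B) then c else 0).
Proof.
move=> xy; rewrite -addrA.
have -> : (if (x \in A) && (y \in B) then c else 0) + (if (y \in A) && (x \in B) then c else 0)
   = \sum_(u in A) ((if u == x then (if y \in B then c else 0) else 0)
                  + (if u == y then (if x \in B then c else 0) else 0)).
  by rewrite big_split /= !vol_if //; case: (x \in A); case: (y \in A).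
rewrite -big_split /=; apply: eq_bigr => u _.
rewrite -(vol_if (fun=>0) y) -(vol_if (fun=>0) x).
have -> : (if u == x then \sum_(v in B) (if v == y then c else 0) else 0)
   + (if u == y then \sum_(v in B) (if v == x then c else 0) else 0)
   = \sum_(v in B) ((if u == x then (if v == y then c else 0) else 0)
                  + (if u == y then (if v == x then c else 0) else 0)).
  rewrite big_split /=; congr (_ + _); case: ifP => //; by rewrite big1.
rewrite -big_split /=; apply: eq_bigr => v _; rewrite /adjust; congr (_ + _).
have [->|_] := eqVneq u x; first by rewrite (negbTE xy) /= orbF addr0.
by rewrite /= add0r; case: (u == y).
Qed.

Lemma cut_adjust w S A x y c : x != y -> x \in S -> y \in S ->
  cut (adjust w x y c) S A = cut w S A + if (x \in A) (+) (y \in A) then c else 0.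
Proof.
move=> xy xS yS; rewrite /cut sum2_adjust // !inE xS yS !andbT.
by case: (x \in A); case: (y \in A) => /=; lia.
Qed.

Lemma cut_setC w S A : (forall x y, w x y = w y x) -> A \subset S ->
  cut w S (S :\: A) = cut w S A.
Proof.
move=> ws AS; rewrite /cut exchange_big /= setDDr setDv set0U (setIidPr AS).
by apply: eq_bigr => u _; apply: eq_bigr => v _.
Qed.

Lemma cut_full w S : cut w S S = 0.
Proof. by rewrite /cut big1 // => u _; rewrite setDv big_set0. Qed.

Lemma cut_ge0 w S A : (forall x y, 0 <= w x y) -> 0 <= cut w S A.
Proof. by move=> w0; apply: sumr_ge0 => x _; apply: sumr_ge0. Qed.

Lemma cut1 w S x : cut w S [set x] = \sum_(y in S :\ x) w x y.
Proof. by rewrite /cut big_set1. Qed.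

(** An edge from [x] to [A] is counted in both cuts but does not leave the union, hence the factor
    2. *)
Lemma cut_setU1 w S A x : (forall x y, w x y = w y x) -> A \subset S -> x \in S -> x \notin A ->
  cut w S (x |: A) = cut w S A + cut w S [set x] - 2 * \sum_(y in A) w x y.
Proof.
move=> ws AS xS xA; rewrite cut1 /cut big_setU1 //=.
have E1 : \sum_(y in S :\ x) w x y =
    \sum_(y in A) w x y + \sum_(y in S :\: (x |: A)) w x y.
  rewrite (big_setID A) /=; congr (_ + _).
    apply: eq_bigl => y; rewrite !inE; case: (eqVneq y x) => [->|_] /=; first by rewrite (negbTE xA).
    by rewrite andbC; case yA: (y \in A) => //=; rewrite (subsetP AS).
  by apply: eq_bigl => y; rewrite !inE negb_or; case: (y == x); case: (y \in A); case: (y \in S).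
have E2 : \sum_(u in A) \sum_(y in S :\: A) w u y =
   \sum_(u in A) w x u + \sum_(u in A) \sum_(y in S :\: (x |: A)) w u y.
  rewrite -big_split /=; apply: eq_bigr => u uA.
  rewrite (bigD1 x) /= ?inE ?xA ?xS // ws; congr (_ + _); apply: eq_bigl => y.
  by rewrite !inE negb_or; case: (y == x); case: (y \in A); case: (y \in S).
by rewrite E1 E2; ring.
Qed.

Lemma cut_setD1 w S A x : (forall x y, w x y = w y x) -> A \subset S -> x \in A ->
  cut w S A = cut w S (A :\ x) + cut w S [set x] - 2 * \sum_(y in A :\ x) w x y.
Proof.
move=> ws AS xA; rewrite -{1}(setD1K xA) cut_setU1 ?(subsetP AS) ?setD11 //.
exact: subset_trans (subD1set _ _) AS.
Qed.

Lemma cut_pair w S x y : (forall x y, w x y = w y x) -> x \in S -> y \in S -> x != y ->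
  cut w S [set x; y] = cut w S [set x] + cut w S [set y] - 2 * w x y.
Proof.
move=> ws xS yS xy; rewrite cut_setU1 ?sub1set ?inE // big_set1 addrC; ring.
Qed.

Lemma cut_nbr w S x : (forall x y, 0 <= w x y) -> cut w S [set x] != 0 ->
  exists2 y, y \in S :\ x & 0 < w x y.
Proof.
move=> w0; rewrite cut1 => H.
case: (pickP [pred y | (y \in S :\ x) && (0 < w x y)]) => [y /andP[yS wxy]|none].
  by exists y.
move/eqP: H; case; apply: big1 => y yS; have := none y; rewrite /= yS /=; have := w0 x y; lia.
Qed.

(* Besides its edges inside [S], a vertex [x] has [ep x] edges oriented to a root outside [S] and [em x]
   edges oriented from it; [b x] is the net outflow that the edges inside [S] must give to [x]. *)
Definition deg w S ep em A : int := cut w S A + vol ep A + vol em A.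

Definition dem b ep em A : int := vol b A + vol ep A - vol em A.

(* [h x y] is the number of edges oriented from [x] to [y]. *)
Definition orients p S h w b : Prop :=
  [/\ forall x y, 0 <= h x y,
      forall x y, x \in S -> y \in S -> x != y -> h x y + h y x = w x y
    & forall x, x \in S -> exists j, \sum_(y in S) (h x y - h y x) = b x + modulus p * j].

Definition orientable p S w b : Prop := exists h, orients p S h w b.

Lemma orients_ext p S h w w' b b' :
  (forall x y, x \in S -> y \in S -> x != y -> w x y = w' x y) -> {in S, b =1 b'} ->
  orients p S h w b -> orients p S h w' b'.
Proof.
move=> ew eb [h0 hw hb]; split=> // [x y xS yS xy|x xS].
  by rewrite hw ?ew.
by have [j E] := hb x xS; exists j; rewrite E eb.
Qed.

Lemma orients_opp p S h w b : orients p S h w b ->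
  orients p S (fun x y => h y x) w (fun x => - b x).
Proof.
case=> h0 hw hb; split=> [x y|x y xS yS xy|x xS]; first exact: h0.
  by rewrite addrC hw.
have [j E] := hb x xS; exists (- j).
by rewrite mulrN -opprD -E -sumrN; apply: eq_bigr => y _; rewrite opprB.
Qed.

Lemma orients_add p S h w b x y c : x \in S -> y \in S -> x != y -> 0 <= h x y + c ->
  orients p S h w b ->
  orients p S (fun u v => h u v + if (u == x) && (v == y) then c else 0)
    (adjust w x y c) (shift (shift b x c) y (- c)).
Proof.
move=> xS yS xy hc [h0 hw hb]; split=> [u v|u v uS vS uv|u uS].
- by case: ifP => [/andP[/eqP-> /eqP->] //|_]; rewrite addr0.
- rewrite /adjust -hw // addrACA; congr (_ + _).
  have [->|_] := eqVneq u x; last by rewrite /= add0r andbC.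
  by rewrite (negbTE xy) andbF orbF /= addr0.
have [j E] := hb u uS; exists j.
have X : \sum_(v in S) (if (u == x) && (v == y) then c else 0) = if u == x then c else 0.
  by case: (u == x) => /=; rewrite ?vol_if ?yS // big1.
have Y : \sum_(v in S) (if (v == x) && (u == y) then c else 0) = if u == y then c else 0.
  by case: (u == y); under eq_bigr do rewrite ?andbT ?andbF; rewrite ?vol_if ?xS // big1.
rewrite /shift.
transitivity (\sum_(v in S) (h u v - h v u) + (if u == x then c else 0) - (if u == y then c else 0)).
  by rewrite -X -Y -big_split /= -sumrB; apply: eq_bigr => v _; ring.
by rewrite E; case: (u == y); ring.
Qed.

(** An edge oriented from [x] to [y] supplies 1 to the outflow of [x] and -1 to that of [y]; after
    its deletion the other edges owe the rest. *)
Lemma orientable_arc p S w b x y : x \in S -> y \in S -> x != y ->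
  orientable p S (adjust w x y (-1)) (shift (shift b x (-1)) y 1) -> orientable p S w b.
Proof.
move=> xS yS xy [h oh]; have [h0 _ _] := oh.
exists (fun u v => h u v + if (u == x) && (v == y) then 1 else 0).
apply: orients_ext (orients_add xS yS xy _ oh) => [u v uS vS uv|u uS|].
- by rewrite /adjust; case: ifP => _; rewrite ?addr0 // addrNK.
- by rewrite /shift; case: (u == x); case: (u == y); ring.
by rewrite addr_ge0.
Qed.

Lemma orientable_opp p S w b : orientable p S w (fun x => - b x) -> orientable p S w b.
Proof.
case=> h /orients_opp oh; eexists; apply: orients_ext oh => // x _.
exact: opprK.
Qed.

Lemma adjustC w x y c u v : adjust w x y c u v = adjust w y x c u v.
Proof. by rewrite /adjust orbC. Qed.

(** Rerouting an arc from [u] to [v] through [x] changes no net outflow; this undoes a lifting. *)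
Lemma orientable_subdivide p S h w w' b x u v : x \in S -> u \in S -> v \in S ->
  u != x -> x != v -> u != v -> 0 <= h u v + -1 -> orients p S h w' b ->
  adjust (adjust (adjust w' u v (-1)) u x 1) x v 1 =2 w -> orientable p S w b.
Proof.
move=> xS uS vS ux xv uv huv oh ew.
have o1 := orients_add uS vS uv huv oh; have [h10 _ _] := o1.
have o2 := orients_add uS xS ux (addr_ge0 (h10 _ _) ler01) o1; have [h20 _ _] := o2.
have o3 := orients_add xS vS xv (addr_ge0 (h20 _ _) ler01) o2.
eexists; apply: orients_ext o3 => [y z _ _ _|y _]; first exact: ew.
by rewrite /shift; case: (y == x); case: (y == u); case: (y == v); ring.
Qed.

Lemma orientable_lift p S w b x u v : x \in S -> u \in S -> v \in S ->
  u != x -> x != v -> u != v -> 0 <= w u v ->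
  orientable p S (adjust (adjust (adjust w u x (-1)) x v (-1)) u v 1) b ->
  orientable p S w b.
Proof.
move=> xS uS vS ux xv uv wuv [h oh]; have [h0 hw _] := oh.
have [xu vx vu] : [/\ x != u, v != x & v != u] by split; rewrite eq_sym.
have E : h u v + h v u = w u v + 1.
  by rewrite hw // /adjust !eqxx (negbTE ux) (negbTE vx) (negbTE uv) /= ?andbF /= !addr0.
(* The lifted graph has an edge between [u] and [v]; whichever direction it received is followed by
   the two original edges. *)
have [huv|hvu] : 0 <= h u v + -1 \/ 0 <= h v u + -1 by have := h0 u v; have := h0 v u; lia.
  apply: (orientable_subdivide xS uS vS ux xv uv huv oh) => y z.
  rewrite /adjust; do 3! case: (_ && _ || _); ring.
apply: (orientable_subdivide xS vS uS vx xu vu hvu oh) => y z.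
rewrite adjustC [LHS]/adjust adjustC [X in X + _]/adjust adjustC /adjust.
do 3! case: (_ && _ || _); ring.
Qed.

End Weighted.

Section Admissible.
Variables (V : finType) (p : nat).
Implicit Types (w h : V -> V -> int) (b f g ep em : V -> int) (S A B : {set V}) (x y u v : V)
  (o : option V).

(** * Admissible instances *)

(* [adm_root] is an explicit form of the bound [P + N <= 4p + nrm (P - N)] on the degree of the root,
   see [root_le] and [root_ge]. The vertex [o], if any, is exempt from [adm_cut]: it has demand 0 and is
   going to be removed by lifting its edges in pairs; its edges inside [S] suffice to balance those
   joining it to the root. *)
Record admissible S w b ep em o : Prop := Admissible {
  adm_w_ge0 : forall x y, 0 <= w x y;
  adm_w_sym : forall x y, w x y = w y x;
  adm_ep_ge0 : forall x, 0 <= ep x;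
  adm_em_ge0 : forall x, 0 <= em x;
  adm_sum : exists j, vol b S = modulus p * j;
  adm_root : [/\ vol ep S <= 4 * p%:Z + 1, vol em S <= 4 * p%:Z + 1
               & vol ep S <= 2 * p%:Z \/ vol em S <= 2 * p%:Z];
  adm_parity : forall A, A \subset S -> (2 %| deg w S ep em A - dem b ep em A)%Z;
  adm_cut : forall A, A \subset S -> A != set0 -> A != S ->
    (forall x, o = Some x -> A != [set x]) ->
    4 * p%:Z + nrm p (dem b ep em A) <= deg w S ep em A;
  adm_exempt : forall x, o = Some x ->
    [/\ x \in S, exists j, dem b ep em [set x] = modulus p * j
      & `|ep x - em x| <= cut w S [set x]] }.

(* By parity, no proper subset with at least two vertices attains the bound of [adm_cut]. *)
Definition slack S w b ep em : Prop := forall A, A \subset S -> (1 < #|A|)%N -> A != S ->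
  4 * p%:Z + 2 + nrm p (dem b ep em A) <= deg w S ep em A.

(* The factor [p + 1] lets [orient_positive] replace an edge of [S] by up to [2p] edges to the root. *)
Definition size_of S w ep em o : int :=
  2 * ((p%:Z + 1) * (\sum_(x in S) \sum_(y in S) w x y) + vol ep S + vol em S)
  + (if o is None then 1 else 0).

Lemma deg_adjust w S ep em A x y c : x != y -> x \in S -> y \in S ->
  deg (adjust w x y c) S ep em A = deg w S ep em A + if (x \in A) (+) (y \in A) then c else 0.
Proof. by move=> *; rewrite /deg cut_adjust //; ring. Qed.

Lemma deg_ep w S ep em A x c :
  deg w S (shift ep x c) em A = deg w S ep em A + if x \in A then c else 0.
Proof. by rewrite /deg vol_shift; ring. Qed.

Lemma deg_em w S ep em A x c :
  deg w S ep (shift em x c) A = deg w S ep em A + if x \in A then c else 0.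
Proof. by rewrite /deg vol_shift; ring. Qed.

Lemma dem_b b ep em A x c :
  dem (shift b x c) ep em A = dem b ep em A + if x \in A then c else 0.
Proof. by rewrite /dem vol_shift; ring. Qed.

Lemma dem_ep b ep em A x c :
  dem b (shift ep x c) em A = dem b ep em A + if x \in A then c else 0.
Proof. by rewrite /dem vol_shift; ring. Qed.

Lemma dem_em b ep em A x c :
  dem b ep (shift em x c) A = dem b ep em A - if x \in A then c else 0.
Proof. by rewrite /dem vol_shift; ring. Qed.

Lemma adjust_ge0 w x y c : (forall u v, 0 <= w u v) -> (forall u v, w u v = w v u) ->
  0 <= w x y + c -> forall u v, 0 <= adjust w x y c u v.
Proof.
move=> w0 ws wc u v; rewrite /adjust; case: ifP; rewrite ?addr0 //.
by case/orP => /andP[/eqP-> /eqP->] //; rewrite ws.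
Qed.

Lemma adjust_sym w x y c : (forall u v, w u v = w v u) ->
  forall u v, adjust w x y c u v = adjust w x y c v u.
Proof.
move=> ws u v; rewrite /adjust (ws u v).
by case: (u == x); case: (u == y); case: (v == x); case: (v == y).
Qed.

Lemma shift_ge0 f x c : (forall u, 0 <= f u) -> 0 <= f x + c -> forall u, 0 <= shift f x c u.
Proof. by move=> f0 fc u; rewrite /shift; case: eqP => [->|]; rewrite ?addr0. Qed.

Lemma dem_setD S w b ep em o A : admissible S w b ep em o -> A \subset S ->
  exists j, dem b ep em (S :\: A) = vol ep S - vol em S - dem b ep em A + modulus p * j.
Proof.
move=> ad AS; have [j E] := adm_sum ad; exists j.
have := vol_setD b AS; have := vol_setD ep AS; have := vol_setD em AS.
by rewrite /dem E; lia.
Qed.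

Lemma deg_setD S w b ep em o A : admissible S w b ep em o -> A \subset S ->
  deg w S ep em (S :\: A) =
  deg w S ep em A - 2 * (vol ep A + vol em A) + vol ep S + vol em S.
Proof.
move=> ad AS; rewrite /deg cut_setC //; last exact: adm_w_sym ad.
by rewrite (vol_setD ep AS) (vol_setD em AS); ring.
Qed.

(** Slack absorbs a loss of 2 on sets with at least two vertices, which covers every local move
    below; only single vertices remain to be checked. *)
Lemma admissible_update S w b ep em o w' b' ep' em' o' :
  admissible S w b ep em o -> slack S w b ep em ->
  (forall x y, 0 <= w' x y) -> (forall x y, w' x y = w' y x) ->
  (forall x, 0 <= ep' x) -> (forall x, 0 <= em' x) -> vol b' S = vol b S ->
  [/\ vol ep' S <= 4 * p%:Z + 1, vol em' S <= 4 * p%:Z + 1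
    & vol ep' S <= 2 * p%:Z \/ vol em' S <= 2 * p%:Z] ->
  (forall A, A \subset S ->
    (2 %| (deg w' S ep' em' A - deg w S ep em A) - (dem b' ep' em' A - dem b ep em A))%Z
    /\ (`|dem b' ep' em' A - dem b ep em A| <= deg w' S ep' em' A - deg w S ep em A + 2)) ->
  (forall u, u \in S -> o' <> Some u -> [set u] != S ->
    nrm p (dem b' ep' em' [set u]) <=
      nrm p (dem b ep em [set u]) + `|dem b' ep' em' [set u] - dem b ep em [set u]| ->
    4 * p%:Z + nrm p (dem b' ep' em' [set u]) <= deg w' S ep' em' [set u]) ->
  (forall x, o' = Some x ->
    [/\ x \in S, exists j, dem b' ep' em' [set x] = modulus p * j
      & `|ep' x - em' x| <= cut w' S [set x]]) ->
  admissible S w' b' ep' em' o'.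
Proof.
move=> ad sl w0 ws ep0 em0 bE rt upd sing ex; split=> //.
- by rewrite bE; exact: adm_sum ad.
- by move=> A AS; have [h _] := upd A AS; have := adm_parity ad AS; lia.
move=> A AS A0 AnS Ax0.
have [A1|A1] := leqP #|A| 1.
  have /cards1P[u Au] : #|A| == 1%N by rewrite eqn_leq A1 card_gt0.
  subst A; apply: sing => //; first by rewrite -sub1set.
    by move=> E; have := Ax0 _ E; rewrite eqxx.
  by rewrite -{1}[dem b' _ _ _](subrK (dem b ep em [set u])) addrC nrm_add.
have [_ h] := upd A AS; have := sl A AS A1 AnS.
have := nrm_add p (dem b ep em A) (dem b' ep' em' A - dem b ep em A).
by rewrite addrC subrK; lia.
Qed.

Lemma size_adjust S w ep em o x y c : x != y -> x \in S -> y \in S ->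
  size_of S (adjust w x y c) ep em o = size_of S w ep em o + 4 * (p%:Z + 1) * c.
Proof. by move=> xy xS yS; rewrite /size_of sum2_adjust // xS yS /=; ring. Qed.

Lemma size_ep S w ep em o x c : x \in S ->
  size_of S w (shift ep x c) em o = size_of S w ep em o + 2 * c.
Proof. by move=> xS; rewrite /size_of vol_shift xS; ring. Qed.

Lemma size_em S w ep em o x c : x \in S ->
  size_of S w ep (shift em x c) o = size_of S w ep em o + 2 * c.
Proof. by move=> xS; rewrite /size_of vol_shift xS; ring. Qed.

Lemma adm_cut1 S w b ep em o u : admissible S w b ep em o -> u \in S -> o <> Some u ->
  [set u] != S -> 4 * p%:Z + nrm p (dem b ep em [set u]) <= deg w S ep em [set u].
Proof.
move=> ad uS ou uS1; apply: (adm_cut ad) => //; first by rewrite sub1set.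
  by apply/set0Pn; exists u; rewrite set11.
by move=> x E; apply/eqP => /set1_inj ux; apply: ou; rewrite ux.
Qed.

(** The inner induction hypothesis: [S] is fixed and the size decreases. *)
Definition smaller_orientable S w ep em o := forall w' b' ep' em' o',
  admissible S w' b' ep' em' o' -> size_of S w' ep' em' o' < size_of S w ep em o ->
  orientable p S w' b'.

Lemma dem_opp b ep em A : dem (fun x => - b x) em ep A = - dem b ep em A.
Proof. by rewrite /dem /vol sumrN; ring. Qed.

Lemma deg_opp w S ep em A : deg w S em ep A = deg w S ep em A.
Proof. by rewrite /deg; ring. Qed.

(** Reversing every edge, those at the root included, lets one sign of the demand stand for both. *)
Lemma admissible_opp S w b ep em o :
  admissible S w b ep em o -> admissible S w (fun x => - b x) em ep o.
Proof.
case=> w0 ws ep0 em0 [j sm] [P N PN] par ct ex; split=> //.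
- by exists (- j); rewrite /vol sumrN -/(vol b S) sm mulrN.
- by split=> //; case: PN; [right|left].
- by move=> A /par; rewrite dem_opp deg_opp; lia.
- by move=> A *; rewrite dem_opp deg_opp nrmN; apply: ct.
move=> x /ex [xS [i E] c]; split=> //; last by rewrite distrC.
by exists (- i); rewrite dem_opp E mulrN.
Qed.

Lemma slack_opp S w b ep em : slack S w b ep em -> slack S w (fun x => - b x) em ep.
Proof.
by move=> sl A *; rewrite dem_opp deg_opp nrmN; apply: sl.
Qed.

Lemma size_opp S w ep em o : size_of S w em ep o = size_of S w ep em o.
Proof. by rewrite /size_of; case: o => *; ring. Qed.

Lemma smaller_opp S w ep em o : smaller_orientable S w ep em o -> smaller_orientable S w em ep o.
Proof.
move=> ih w' b' ep' em' o' /admissible_opp ad lt.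
apply/orientable_opp/(ih _ _ _ _ _ ad).
by rewrite (size_opp S w' ep') -(size_opp S w ep).
Qed.

Ltac update := rewrite ?deg_adjust ?deg_ep ?deg_em ?dem_b ?dem_ep ?dem_em //.

(** * Lifting the edges of the exempt vertex *)

(** An edge to the root and one from it cancel at [x], so both can be deleted. *)
Lemma exempt_drop S w b ep em x : admissible S w b ep em (Some x) -> slack S w b ep em ->
  smaller_orientable S w ep em (Some x) -> 0 < ep x -> 0 < em x -> orientable p S w b.
Proof.
move=> ad sl ih epx emx; have [xS [j E] c] := adm_exempt ad erefl.
apply: (ih w b (shift ep x (-1)) (shift em x (-1)) (Some x)); last first.
  by rewrite size_ep ?size_em //; lia.
have [w0 ws ep0 em0 _ [P N PN] _ _ _] := ad.
apply: (admissible_update ad sl) => //.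
- by apply: shift_ge0 => //; lia.
- by apply: shift_ge0 => //; lia.
- by rewrite !vol_shift xS; split; lia.
- by move=> A AS; update; case: (x \in A); lia.
- move=> u uS ou uS1; have := adm_cut1 ad uS ou uS1.
  by update; rewrite !inE; case: (eqVneq u x) ou => [->|_ _] //; lia.
move=> _ [<-]; split=> //; first by exists j; rewrite -E; update; rewrite set11; ring.
by move: c; rewrite /shift eqxx; lia.
Qed.

(** The path from [y] through [x] to the root becomes an edge from [y] to the root; degree and
    demand of [y] stay the same. *)
Lemma exempt_move S w b ep em x y : admissible S w b ep em (Some x) -> slack S w b ep em ->
  smaller_orientable S w ep em (Some x) -> y \in S -> x != y ->
  0 < ep x -> em x = 0 -> 0 < w x y -> orientable p S w b.
Proof.
move=> ad sl ih yS xy epx emx wxy; have yx : y != x by rewrite eq_sym.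
have [xS [j E] c] := adm_exempt ad erefl.
apply: (orientable_arc yS xS yx).
apply: (ih _ _ (shift (shift ep x (-1)) y 1) em (Some x)); last first.
  by rewrite size_adjust // !size_ep //; lia.
have [w0 ws ep0 em0 _ [P N PN] _ _ _] := ad.
apply: (admissible_update ad sl) => //.
- by apply: adjust_ge0 => //; rewrite ws; lia.
- exact: adjust_sym.
- by apply: shift_ge0 => [|]; [apply: shift_ge0 => // | rewrite /shift (negbTE yx); have := ep0 y]; lia.
- by rewrite !vol_shift xS yS; ring.
- by rewrite !vol_shift xS yS; split; lia.
- by move=> A AS; update; case: (x \in A); case: (y \in A) => /=; lia.
- move=> u uS ou uS1; have := adm_cut1 ad uS ou uS1.
  update; rewrite !inE; case: (eqVneq x u) ou => [->|_ _] //.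
  by case: (y == u) => /=; lia.
move=> _ [<-]; split=> //.
  by exists j; rewrite -E; update; case: (x \in _); case: (y \in _); ring.
rewrite cut_adjust // !inE eqxx (negbTE yx) /= /shift eqxx (negbTE xy) /=.
by move: c; lia.
Qed.

(** Each neighbour trades its edge to [x] for the new edge, so both keep their degrees. *)
Lemma exempt_lift S w b ep em x u v : admissible S w b ep em (Some x) -> slack S w b ep em ->
  smaller_orientable S w ep em (Some x) -> u \in S -> v \in S -> u != x -> x != v -> u != v ->
  ep x = 0 -> em x = 0 -> 0 < w u x -> 0 < w x v -> orientable p S w b.
Proof.
move=> ad sl ih uS vS ux xv uv epx emx wux wxv.
have [xS dx c] := adm_exempt ad erefl; have [w0 ws ep0 em0 _ rt _ _ _] := ad.
have vx : v != x by rewrite eq_sym.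
have s1 := adjust_sym u x (-1) ws.
have s2 := adjust_sym x v (-1) s1.
have g1 : forall y z, 0 <= adjust w u x (-1) y z by apply: adjust_ge0 => //; lia.
have g2 : forall y z, 0 <= adjust (adjust w u x (-1)) x v (-1) y z.
  apply: adjust_ge0 => //; rewrite /adjust (negbTE vx) (eq_sym v u) (negbTE uv).
  by rewrite !andbF /=; lia.
have g3 : forall y z, 0 <= adjust (adjust (adjust w u x (-1)) x v (-1)) u v 1 y z.
  by apply: adjust_ge0 => //; have := g2 u v; lia.
apply: (orientable_lift xS uS vS ux xv uv (w0 _ _)).
apply: (ih _ _ ep em (Some x)); last by rewrite !size_adjust //; lia.
apply: (admissible_update ad sl) => //.
- exact: adjust_sym.
- by move=> A AS; update; case: (x \in A); case: (u \in A); case: (v \in A) => /=; lia.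
- move=> y yS oy yS1; have := adm_cut1 ad yS oy yS1.
  update; rewrite !inE; case: (eqVneq x y) oy => [->|_ _] //.
  case: (eqVneq u y) => [uy|_]; case: (eqVneq v y) => [vy|_] /=; try lia.
  by move: uv; rewrite uy vy eqxx.
by move=> _ [<-]; split=> //; rewrite epx emx; apply: cut_ge0.
Qed.

(** Lifting two parallel edges would give a loop at [y]; instead they are oriented oppositely and
    deleted. This costs [y] two edges, hence the last hypothesis. *)
Lemma exempt_parallel S w b ep em x y : admissible S w b ep em (Some x) -> slack S w b ep em ->
  smaller_orientable S w ep em (Some x) -> y \in S -> x != y -> ep x = 0 -> em x = 0 -> 1 < w x y ->
  4 * p%:Z + 2 + nrm p (dem b ep em [set y]) <= deg w S ep em [set y] -> orientable p S w b.
Proof.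
move=> ad sl ih yS xy epx emx wxy ly; have yx : y != x by rewrite eq_sym.
have [xS dx c] := adm_exempt ad erefl; have [w0 ws ep0 em0 _ rt _ _ _] := ad.
have g : forall u v, 0 <= adjust w x y (-2) u v by apply: adjust_ge0 => //; lia.
suff [h oh] : orientable p S (adjust w x y (-2)) b.
  apply: (orientable_arc xS yS xy); apply: (orientable_arc yS xS yx); exists h.
  apply: orients_ext oh => [u v _ _ _|u _].
    by rewrite [RHS]adjustC /adjust; case: (_ && _ || _); ring.
  by rewrite /shift; case: (u == x); case: (u == y); ring.
apply: (ih _ _ ep em (Some x)); last by rewrite !size_adjust //; lia.
apply: (admissible_update ad sl) => //.
- exact: adjust_sym.
- by move=> A AS; update; case: (x \in A); case: (y \in A) => /=; lia.
- move=> u uS ou uS1; have := adm_cut1 ad uS ou uS1.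
  update; rewrite !inE; case: (eqVneq x u) ou => [->|_ _] //.
  by case: (eqVneq y u) => [<-|_] /=; lia.
by move=> _ [<-]; split=> //; rewrite epx emx; apply: cut_ge0.
Qed.

Lemma deg1 S w ep em x : deg w S ep em [set x] = cut w S [set x] + ep x + em x.
Proof. by rewrite /deg !vol1. Qed.

Lemma dem1 b ep em x : dem b ep em [set x] = b x + ep x - em x.
Proof. by rewrite /dem !vol1. Qed.

(* Otherwise the edges to the root would number at least [8p], while [adm_root] allows at most [6p+1]. *)
Lemma cut1_gt0 S w b ep em x : (0 < p)%N -> admissible S w b ep em None -> slack S w b ep em ->
  (2 < #|S|)%N -> x \in S -> 0 < cut w S [set x].
Proof.
move=> p0 ad sl S3 xS; have [w0 ws ep0 em0 _ [P N PN] _ _ ex] := ad.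
have := cut_ge0 S [set x] w0; rewrite le_eqVlt => /predU1P[c0|//].
have S1 : [set x] != S by apply/eqP => E; rewrite -E cards1 in S3.
have := adm_cut1 ad xS _ S1 => /(_ ltac:(by [])); rewrite deg1 -c0.
have xs : [set x] \subset S by rewrite sub1set.
have cD : #|S :\ x| = #|S|.-1 by rewrite (cardsD1 x S) xS.
have := sl (S :\ x) (subsetDl _ _); rewrite (deg_setD ad xs) deg1 -c0 !vol1 cD.
have nS : S :\ x != S by apply/eqP => E; have := cD; rewrite E; lia.
move=> /(_ _ nS) H1 H2; have {}H1 := H1 ltac:(lia).
have := nrm_le p (dem b ep em (S :\ x)); have := nrm_le p (dem b ep em [set x]).
lia.
Qed.

(** Root edges at [x] are treated first, then pairs of edges to distinct neighbours, and finally,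
    when a single neighbour is left, parallel edges. *)
Lemma orient_exempt S w b ep em x : admissible S w b ep em (Some x) ->
  slack S w b ep em -> smaller_orientable S w ep em (Some x) -> (2 < #|S|)%N ->
  cut w S [set x] != 0 -> orientable p S w b.
Proof.
move=> ad sl ih S3 c0; have [w0 ws ep0 em0 _ _ _ _ _] := ad.
have [xS [j E] _] := adm_exempt ad erefl.
have [y] := cut_nbr w0 c0; rewrite !inE => /andP[yx yS] wxy.
have xy : x != y by rewrite eq_sym.
have [epx|] := ltP 0 (ep x).
  have [emx|emx] := ltP 0 (em x); first exact: (exempt_drop ad sl ih).
  by apply: (exempt_move ad sl ih yS xy) => //; have := em0 x; lia.
move=> epx; have {}epx : ep x = 0 by have := ep0 x; lia.
have [emx|emx] := ltP 0 (em x).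
  apply: orientable_opp.
  exact: (exempt_move (admissible_opp ad) (slack_opp sl) (smaller_opp ih) yS xy).
have {}emx : em x = 0 by have := em0 x; lia.
have [[v [vx vy vS] wxv]|only] : (exists2 v, [/\ v != x, v != y & v \in S] & 0 < w x v) \/
    cut w S [set x] = w x y.
  case: (pickP [pred v | [&& v != x, v != y, v \in S & 0 < w x v]]) => [v /and4P[? ? ? ?]|none].
    by left; exists v.
  right; rewrite cut1 (bigD1 y) /= ?inE ?yx // big1 ?addr0 // => v; rewrite !inE.
  case/andP=> /andP[vx vS] vy; have := none v; rewrite /= vx vy vS /=; have := w0 x v; lia.
  by apply: (exempt_lift ad sl ih yS vS yx _ _ epx emx) => //; rewrite ?(eq_sym x) ?(eq_sym y) // ws.
(* The cut of the pair misses the [w x y] edges at [y], and the demand of [x] is 0 modulo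
   [modulus p]; so slack of the pair gives slack at [y]. By parity [w x y] is even. *)
have pS : [set x; y] \subset S by rewrite subUset !sub1set xS yS.
have c2 : #|[set x; y]| = 2%N by rewrite cards2 xy.
have nS : [set x; y] != S by apply/eqP => E1; rewrite -E1 c2 in S3.
have := sl _ pS; rewrite c2 => /(_ isT nS) sp.
have dpair : deg w S ep em [set x; y] = deg w S ep em [set y] - w x y.
  rewrite /deg cut_pair // only /vol !big_setU1 ?inE //= !big_set1 epx emx; ring.
have zpair : dem b ep em [set x; y] = dem b ep em [set x] + dem b ep em [set y].
  by rewrite /dem /vol !big_setU1 ?inE //= !big_set1; ring.
have := adm_parity ad (A := [set x]); rewrite sub1set => /(_ xS) parx.
rewrite deg1 only epx emx E /modulus in parx.
apply: (exempt_parallel ad sl ih yS xy) => //; first by lia.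
by move: sp; rewrite zpair E (addrC (modulus p * j)) nrm_period dpair; lia.
Qed.

(** * Instances without tight sets *)

(** If 0 is the multiple nearest to [P - N], the bound says that the smaller of [P] and [N] is at
    most [2p]; if it is plus or minus the modulus, that the larger is at most [4p + 1]. *)
Lemma root_le (P N : int) : 0 <= P -> 0 <= N ->
  [/\ P <= 4 * p%:Z + 1, N <= 4 * p%:Z + 1 & P <= 2 * p%:Z \/ N <= 2 * p%:Z] ->
  P + N <= 4 * p%:Z + nrm p (P - N).
Proof.
move=> P0 N0 [P4 N4 PN]; have [t [j [E -> lt]]] := nrm_spec p (P - N).
rewrite /modulus in E.
have [j0|[j1|j1]] : j = 0 \/ 1 <= j \/ j <= -1 by lia.
- by subst j; lia.
- have : (4 * p%:Z + 2) * j >= 4 * p%:Z + 2 by nia.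
  lia.
have : (4 * p%:Z + 2) * j <= - (4 * p%:Z + 2) by nia.
lia.
Qed.

Lemma root_ge (P N : int) : 0 <= P -> 0 <= N -> P + N <= 4 * p%:Z + nrm p (P - N) ->
  [/\ P <= 4 * p%:Z + 1, N <= 4 * p%:Z + 1 & P <= 2 * p%:Z \/ N <= 2 * p%:Z].
Proof.
move=> P0 N0 le; have := nrm_le p (P - N).
have n0 := @nrm_min p (P - N) (P - N) 0 ltac:(lia).
have n1 := @nrm_min p (P - N) (P - N - modulus p) 1 ltac:(lia).
have n2 := @nrm_min p (P - N) (P - N + modulus p) (-1) ltac:(lia).
by rewrite /modulus in n1 n2; split; lia.
Qed.

(** Without inner edges at [x], [adm_exempt] makes its root edges balance, so [b x] is a multiple of
    the modulus and [x] can be discarded. *)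
Lemma orient_isolated S w b ep em x : admissible S w b ep em (Some x) ->
  cut w S [set x] = 0 ->
  (admissible (S :\ x) w b ep em None -> orientable p (S :\ x) w b) -> orientable p S w b.
Proof.
move=> ad c0 ih; have [w0 ws ep0 em0 [j sm] [P N PN] par ct ex] := ad.
have [xS [i]] := ex x erefl; rewrite c0 dem1 => bx epm.
have wx y : y \in S -> y != x -> w x y = 0.
  move=> yS yx; apply/eqP; move/eqP: c0; rewrite cut1 psumr_eq0 // => /allP/(_ y).
  by rewrite mem_index_enum !inE yx yS => /(_ isT)/implyP->.
have volx f : vol f S = f x + vol f (S :\ x) by rewrite /vol (big_setD1 x).
have cutx A : A \subset S :\ x -> cut w (S :\ x) A = cut w S A.
  move=> AS; apply: eq_bigr => u uA; have := subsetP AS u uA; rewrite !inE => /andP[ux uS].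
  rewrite [RHS](bigD1 x) /=; last by rewrite inE xS andbT; apply: contraL AS => xA; apply/subsetPn; exists x; rewrite ?setD11.
  rewrite ws wx // add0r; apply: eq_bigl => v; rewrite !inE; case: (v == x); rewrite ?andbF //= andbT //.
case: ih => [|h [h0 hw hb]].
  split=> //.
  - by exists (j - i); move: sm; rewrite volx; lia.
  - have := vol_ge0 [set x] ep0; have := vol_ge0 [set x] em0; rewrite !vol1.
    by move: P N PN; rewrite !volx; split; lia.
  - move=> A AS; rewrite /deg cutx //; apply: par; exact: subset_trans AS (subsetDl _ _).
  move=> A AS A0 AnS _; have AS' := subset_trans AS (subsetDl _ _).
  have xA : x \notin A by apply: contraL AS => xA; apply/subsetPn; exists x; rewrite ?setD11.
  rewrite /deg cutx //; apply: ct => //.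
    by apply: contraNneq xA => ->.
  by move=> y [<-]; apply: contraNneq xA => ->; rewrite set11.
exists (fun u v => if (u == x) || (v == x) then 0 else h u v); split.
- by move=> u v; case: ifP.
- move=> u v uS vS uv; rewrite orbC.
  have [ux|ux] := eqVneq u x; first by rewrite orbT ux wx // -ux eq_sym.
  have [vx|vx] := eqVneq v x; first by rewrite ws vx wx.
  by rewrite /= hw // !inE ?ux ?vx.
move=> u uS; have [->|ux] := eqVneq u x.
  by exists (- i); rewrite big1 => [|y _]; rewrite ?orbT //=; lia.
have [k E] : exists k, \sum_(y in S :\ x) (h u y - h y u) = b u + modulus p * k.
  by apply: hb; rewrite !inE ux.
exists k; rewrite (big_setD1 x) //= eqxx ?orbT subrr add0r -E; apply: eq_bigr => y.
by rewrite !inE => /andP[yx _]; rewrite (negbTE yx).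
Qed.

(** Making [x] exempt lowers the size by 1. Slack of [S :\ x], compared with [root_le], shows that
    [x] has enough inner edges. *)
Lemma orient_zero S w b ep em x j : admissible S w b ep em None -> slack S w b ep em ->
  smaller_orientable S w ep em None -> (2 < #|S|)%N -> x \in S ->
  dem b ep em [set x] = modulus p * j -> orientable p S w b.
Proof.
move=> ad sl ih S3 xS zx; have [w0 ws ep0 em0 sm rt par ct ex] := ad.
have xs : [set x] \subset S by rewrite sub1set.
apply: (ih w b ep em (Some x)); last by rewrite /size_of; lia.
split=> // [A AS A0 AnS _|_ [<-]]; first exact: ct.
split=> //; first by exists j.
have cD : #|S :\ x| = #|S|.-1 by rewrite (cardsD1 x S) xS.
have nS : S :\ x != S by apply/eqP => E; have := cD; rewrite E; lia.
have := sl (S :\ x) (subsetDl _ _); rewrite (deg_setD ad xs) deg1 !vol1 cD.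
move=> /(_ ltac:(lia) nS); have [i ->] := dem_setD ad xs.
rewrite nrm_period zx -mulrN nrm_period.
have := root_le (vol_ge0 S ep0) (vol_ge0 S em0) rt; have := ep0 x; have := em0 x.
lia.
Qed.

(** Here and in [orient_opposite], the degree lost at a vertex is paid for by the drop of [nrm] of
    its demand. *)
Lemma orient_root_edge S w b ep em x : admissible S w b ep em None -> slack S w b ep em ->
  smaller_orientable S w ep em None -> (2 < #|S|)%N -> x \in S ->
  nrm p (dem b ep em [set x] - 1) < nrm p (dem b ep em [set x]) -> 0 < ep x -> orientable p S w b.
Proof.
move=> ad sl ih S3 xS zx epx; have [w0 ws ep0 em0 sm [P N PN] par ct ex] := ad.
apply: (ih w b (shift ep x (-1)) em None); last by rewrite size_ep //; lia.
apply: (admissible_update ad sl) => //.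
- by apply: shift_ge0 => //; lia.
- by rewrite vol_shift xS; split; lia.
- by move=> A AS; update; case: (x \in A); lia.
move=> u uS ou uS1; have := adm_cut1 ad uS ou uS1.
by update; rewrite !inE; case: (eqVneq x u) zx => [<-|_]; lia.
Qed.

Lemma orient_opposite S w b ep em x y : admissible S w b ep em None -> slack S w b ep em ->
  smaller_orientable S w ep em None -> (2 < #|S|)%N -> x \in S -> y \in S -> x != y -> 0 < w x y ->
  nrm p (dem b ep em [set x] - 1) < nrm p (dem b ep em [set x]) ->
  nrm p (dem b ep em [set y] + 1) < nrm p (dem b ep em [set y]) -> orientable p S w b.
Proof.
move=> ad sl ih S3 xS yS xy wxy zx zy; have [w0 ws ep0 em0 sm rt par ct ex] := ad.
have yx : y != x by rewrite eq_sym.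
apply: (orientable_arc xS yS xy); apply: (ih _ _ ep em None); last by rewrite size_adjust //; lia.
apply: (admissible_update ad sl) => //.
- by apply: adjust_ge0 => //; lia.
- exact: adjust_sym.
- by rewrite !vol_shift xS yS; ring.
- by move=> A AS; update; case: (x \in A); case: (y \in A) => /=; lia.
move=> u uS ou uS1; have := adm_cut1 ad uS ou uS1.
update; rewrite !inE; case: (eqVneq x u) => [<-|_].
  by rewrite (negbTE yx) /= !addr0; lia.
by case: (eqVneq y u) => [<-|_] /=; rewrite !addr0; lia.
Qed.

(* Adding [2p + 1 - nrm] edges from [x] to the root brings the demand at [x] to the extreme [2p + 1], from which
   it decreases in both directions; an arc from [y] to [x] then becomes harmless at both ends. *)
Lemma orient_positive S w b ep em x y : admissible S w b ep em None -> slack S w b ep em ->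
  smaller_orientable S w ep em None -> (2 < #|S|)%N -> x \in S -> y \in S -> x != y -> 0 < w x y ->
  vol ep S = 0 ->
  (forall u, u \in S -> nrm p (dem b ep em [set u] - 1) < nrm p (dem b ep em [set u])
     /\ nrm p (dem b ep em [set u]) <= nrm p (dem b ep em [set u] + 1)) -> orientable p S w b.
Proof.
move=> ad sl ih S3 xS yS xy wxy P0 pos; have [w0 ws ep0 em0 sm [P N PN] par ct ex] := ad.
have yx : y != x by rewrite eq_sym.
have [t [j [zx nx lt]]] := nrm_spec p (dem b ep em [set x]).
have [d1 d2] := pos x xS.
(* The representatives [t + 1] and [t + 1 - modulus p] of the raised demand, together with [d1],
   leave [t] between 1 and [2p]; so [c] lies in the same range. *)
have m1 := @nrm_min p (dem b ep em [set x] + 1) (t + 1) j ltac:(lia).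
have m2 := @nrm_min p (dem b ep em [set x] + 1) (t + 1 - modulus p) (j + 1) ltac:(lia).
rewrite /modulus in m2.
have t1 : 1 <= t <= 2 * p%:Z by have := nrm_le p (dem b ep em [set x] - 1); lia.
pose c := 2 * p%:Z + 1 - t.
apply: (orientable_arc yS xS yx); apply: (ih _ _ (shift ep x c) em None); last first.
  by rewrite size_adjust // size_ep // /c; lia.
have [dy1 dy2] := pos y yS.
apply: (admissible_update ad sl) => //.
- by apply: adjust_ge0 => //; rewrite ws; lia.
- exact: adjust_sym.
- by apply: shift_ge0 => //; have := ep0 x; rewrite /c; lia.
- by rewrite !vol_shift xS yS; ring.
- by rewrite vol_shift xS P0; split=> //; rewrite /c; lia.
- by move=> A AS; update; rewrite /c; case: (x \in A); case: (y \in A) => /=; lia.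
move=> u uS ou uS1; have := adm_cut1 ad uS ou uS1.
update; rewrite !inE; case: (eqVneq x u) => [<-|_] /=.
  rewrite (negbTE yx) /= !addr0 => h _.
  (* Modulo [modulus p] the demand at [x] becomes [2p + 2], at distance [2p]: distance and degree
     both grow by [c - 1]. *)
  have := @nrm_min p (dem b ep em [set x] + c + 1) (- (2 * p%:Z)) (j + 1).
  by rewrite zx /c /modulus => /(_ ltac:(lia)); lia.
by case: (eqVneq y u) => [<-|_] /=; rewrite !addr0; lia.
Qed.

Lemma nrm_neighbours z : 0 < nrm p z ->
  nrm p (z - 1) < nrm p z \/ nrm p (z + 1) < nrm p z.
Proof.
have [t [j [E -> lt]]] := nrm_spec p z => t0.
have m1 := @nrm_min p (z - 1) (t - 1) j ltac:(lia).
have m2 := @nrm_min p (z + 1) (t + 1) j ltac:(lia).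
by case: (ltP 0 t) => h; [left|right]; lia.
Qed.

Lemma nrm0 z : nrm p z = 0 -> exists j, z = modulus p * j.
Proof. have [t [j [E -> lt]]] := nrm_spec p z => t0; exists j; lia. Qed.

(** If no orientation exists, each vertex is positive or negative and none is both, as it would be
    opposite to any neighbour. No edge joins the two classes, so either one class is all of [S] and
    [orient_positive] applies up to reversal, or the root has too many edges. *)
Lemma orient_tight S w b ep em : (0 < p)%N -> admissible S w b ep em None ->
  slack S w b ep em -> smaller_orientable S w ep em None -> (2 < #|S|)%N -> orientable p S w b.
Proof.
move=> p0 ad sl ih S3; apply: NNPP => no.
have [w0 ws ep0 em0 sm [P N PN] par ct ex] := ad.
have nbr x : x \in S -> exists2 y, [/\ y \in S, x != y & y != x] & 0 < w x y.
  move=> xS; have := cut1_gt0 p0 ad sl S3 xS; rewrite lt0r => /andP[c0 _].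
  have [y] := cut_nbr w0 c0; rewrite !inE => /andP[yx yS] wxy.
  by exists y => //; rewrite eq_sym.
have nz x : x \in S -> 0 < nrm p (dem b ep em [set x]).
  move=> xS; have := nrm_le p (dem b ep em [set x]) => /andP[].
  rewrite le_eqVlt => /predU1P[/esym/nrm0[j zj] _|//].
  by case: no; apply: orient_zero zj.
pose pos x := nrm p (dem b ep em [set x] - 1) < nrm p (dem b ep em [set x]).
pose neg x := nrm p (dem b ep em [set x] + 1) < nrm p (dem b ep em [set x]).
have pn x : x \in S -> pos x \/ neg x by move=> xS; apply/nrm_neighbours/nz.
have ad' := admissible_opp ad; have sl' := slack_opp sl; have ih' := smaller_opp ih.
have Epos x : x \in S -> pos x -> ep x = 0.
  move=> xS px; have := ep0 x; rewrite le_eqVlt => /predU1P[//|h].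
  by case: no; apply: orient_root_edge px h.
have Eneg x : x \in S -> neg x -> em x = 0.
  move=> xS px; have := em0 x; rewrite le_eqVlt => /predU1P[//|h].
  case: no; apply: orientable_opp; apply: (orient_root_edge ad' sl' ih') h => //.
  by rewrite dem_opp -opprD !nrmN.
have opp x y : x \in S -> y \in S -> x != y -> pos x -> neg y -> w x y = 0.
  move=> xS yS xy px ny; have := w0 x y; rewrite le_eqVlt => /predU1P[//|h].
  by case: no; apply: (orient_opposite ad sl ih) h px ny.
have ambi x : x \in S -> pos x -> neg x -> False.
  move=> xS px nx; have [y [yS xy yx] wxy] := nbr x xS.
  have [py|ny] := pn y yS.
    by have := opp y x yS xS yx py nx; rewrite ws; lia.
  by have := opp x y xS yS xy px ny; lia.
pose A := [set x in S | pos x].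
have AS : A \subset S by apply/subsetP => x; rewrite inE => /andP[].
have cA : cut w S A = 0.
  rewrite /cut big1 // => x; rewrite inE => /andP[xS px]; rewrite big1 // => y.
  rewrite !inE negb_and => /andP[+ yS]; rewrite yS /= => py.
  have [py'|ny] := pn y yS; first by rewrite py' in py.
  by apply: opp => //; apply: contraNneq py => <-.
have [A0|A0] := eqVneq A set0.
  have neg_all x : x \in S -> neg x /\ ~~ pos x.
    move=> xS; have nx : ~~ pos x.
      by apply/negP => px; have := in_set0 x; rewrite -A0 inE xS px.
    by have [px|] := pn x xS; rewrite ?px in nx *.
  have [x xS] : exists x, x \in S by apply/card_gt0P; lia.
  have [y [yS xy yx] wxy] := nbr x xS.
  case: no; apply: orientable_opp; apply: (orient_positive ad' sl' ih' S3 xS yS xy wxy).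
    by apply: big1 => u uS; apply: Eneg => //; have [] := neg_all u uS.
  move=> u uS; have [] := neg_all u uS; rewrite /neg /pos -leNgt !dem_opp.
  by rewrite -opprD nrmN -[X in _ /\ _ <= nrm _ (_ + X)]opprK -opprD !nrmN.
have [AE|AnS] := eqVneq A S.
  have pos_all x : x \in S -> pos x by rewrite -{1}AE inE => /andP[].
  have [x xS] : exists x, x \in S by apply/card_gt0P; lia.
  have [y [yS xy yx] wxy] := nbr x xS.
  case: no; apply: (orient_positive ad sl ih S3 xS yS xy wxy).
    by apply: big1 => u uS; apply: Epos => //; exact: pos_all.
  move=> u uS; split; first exact: pos_all.
  by rewrite leNgt; apply/negP => nu; apply: ambi (pos_all u uS) nu.
(* The cut of [A] is empty, so [A] and its complement each have at least [4p] root edges, while the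
   root has at most [6p + 1]. *)
have := ct A AS A0 AnS ltac:(by []).
have := ct (S :\: A) (subsetDl _ _) _ _ ltac:(by []).
rewrite (deg_setD ad AS) /deg cA.
have := nrm_le p (dem b ep em A); have := nrm_le p (dem b ep em (S :\: A)).
move=> n1 n2 H1 H2; have {}H1 : 4 * p%:Z <= vol ep S + vol em S - vol ep A - vol em A.
  have := H1; suff [-> ->] : S :\: A != set0 /\ S :\: A != S by move=> /(_ isT isT); lia.
  split.
    by apply: contra AnS; rewrite setD_eq0 => SA; rewrite eqEsubset AS.
  case/set0Pn: A0 => x xA; apply: contraTneq (xA) => E.
  by have := subsetP AS x xA; rewrite -E inE => /andP[].
lia.
Qed.

(** * Contraction of a tight set *)

(** This spreads a prescribed total over [A] within the capacities [f], one unit at a time: below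
    full capacity some vertex has room. *)
Lemma vol_split A f (n : int) : (forall x, 0 <= f x) -> 0 <= n <= vol f A ->
  exists2 g, forall x, 0 <= g x <= f x & vol g A = n.
Proof.
move=> f0; case: n => // n /andP[_]; elim: n => [_|n IH lt].
  by exists (fun=> 0) => [x|]; [rewrite lexx f0 | rewrite /vol big1].
have [|g g01 gn] := IH; first by lia.
case: (pickP [pred x | (x \in A) && (g x < f x)]) => [x /andP[xA gx]|none].
  exists (shift g x 1) => [y|]; last by rewrite vol_shift xA gn; lia.
  by rewrite /shift; case: (eqVneq y x) => [->|_]; have := g01 x; have := g01 y; lia.
have : vol f A <= vol g A.
  by apply: ler_sum => x xA; have := none x; rewrite /= xA /= => /negbT; rewrite -leNgt.
by rewrite gn; lia.
Qed.

Definition fibre_sum (q : V -> V) S f i : int := \sum_(x in S | q x == i) f x.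

Definition preim_in (q : V -> V) S B : {set V} := [set x in S | q x \in B].

Lemma vol_fibre_sum q S f B : vol (fibre_sum q S f) B = vol f (preim_in q S B).
Proof.
rewrite [RHS]/vol (partition_big q (mem B)) /=; last by move=> x; rewrite inE => /andP[].
apply: eq_bigr => i iB; apply: eq_bigl => x; rewrite inE -andbA; congr (_ && _).
by case: eqP => [->|]; rewrite ?iB ?andbF.
Qed.

(** Edges inside a fibre become loops and are dropped; parallel edges are merged by adding
    multiplicities. *)
Definition quotient_weight (q : V -> V) S w i j : int :=
  if i == j then 0 else fibre_sum q S (fun x => fibre_sum q S (w x) j) i.

Lemma cut_quotient q S S' w B : {in S, forall x, q x \in S'} -> B \subset S' ->
  cut (quotient_weight q S w) S' B = cut w S (preim_in q S B).
Proof.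
move=> qS BS.
transitivity (vol (fibre_sum q S (fun x => vol (fibre_sum q S (w x)) (S' :\: B))) B).
  apply: eq_bigr => i iB; rewrite /fibre_sum exchange_big /=; apply: eq_bigr => j.
  rewrite inE => /andP[jB _]; rewrite /quotient_weight.
  by case: eqP => [ij|//]; rewrite -ij iB in jB.
rewrite vol_fibre_sum; apply: eq_bigr => x _; rewrite vol_fibre_sum.
apply: eq_bigl => y; rewrite !inE negb_and; case yS: (y \in S); rewrite ?andbF //=.
by rewrite qS // andbT.
Qed.

Lemma quotient_weight_sym q S w i j : (forall x y, w x y = w y x) ->
  quotient_weight q S w i j = quotient_weight q S w j i.
Proof.
move=> ws; rewrite /quotient_weight eq_sym; case: eqP => // _.
by rewrite /fibre_sum exchange_big /=; do 2! (apply: eq_bigr => ? _).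
Qed.

Lemma fibre_sum_ge0 q S f i : (forall x, 0 <= f x) -> 0 <= fibre_sum q S f i.
Proof. by move=> f0; apply: sumr_ge0. Qed.

Definition collapse A a x : V := if x \in A then a else x.

Section Collapse.
Variables (S A : {set V}) (a : V).
Hypotheses (AS : A \subset S) (aA : a \in A).

Let q := collapse A a.
Let S' := a |: (S :\: A).

Lemma fibre_collapse_out f y : y \in S :\: A -> fibre_sum q S f y = f y.
Proof.
rewrite inE => /andP[yA yS]; rewrite /fibre_sum (big_pred1 y) // => x /=.
rewrite /q /collapse; case: (boolP (x \in A)) => xA.
  by apply/andP/eqP => [[_ /eqP ay]|xy]; [rewrite -ay aA in yA | rewrite xy (negbTE yA) in xA].
by case: eqP => [->|]; rewrite ?yS ?andbF.
Qed.

Lemma fibre_collapse_in f : fibre_sum q S f a = vol f A.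
Proof.
apply: eq_bigl => x; rewrite /q /collapse; case: (boolP (x \in A)) => xA.
  by rewrite eqxx andbT (subsetP AS).
by apply/andP => -[_ /eqP xa]; rewrite xa aA in xA.
Qed.

Lemma collapse_in x : x \in S -> q x \in S'.
Proof. by rewrite /q /collapse !inE; case: ifP => [_ _|xA xS]; rewrite ?eqxx // xA xS orbT. Qed.

Lemma collapse_preimage B x : B \subset S' -> x \in B -> x \in preim_in q S B.
Proof.
move=> BS xB; rewrite inE /q /collapse; have := subsetP BS x xB; rewrite !inE.
case/predU1P=> [xa|/andP[xA xS]]; last by rewrite (negbTE xA) xB xS.
by rewrite xa aA (subsetP AS _ aA) -xa.
Qed.

Lemma preim_sub B : preim_in q S B \subset S.
Proof. by apply/subsetP => x; rewrite inE => /andP[]. Qed.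

Lemma collapse_id i : i \in S' -> q i = i /\ i \in S.
Proof.
rewrite !inE /q /collapse => /predU1P[->|/andP[/negbTE-> ->]] //.
by rewrite aA (subsetP AS).
Qed.

Lemma preim_full : preim_in q S S' = S.
Proof. by apply/setP => x; rewrite inE; case: (boolP (x \in S)) => // /collapse_in ->. Qed.

Lemma preim_neq B : B \subset S' -> B != S' -> preim_in q S B != S.
Proof.
move=> BS; apply: contraNneq => E; rewrite eqEsubset BS; apply/subsetP => i iS.
by have [qi iS1] := collapse_id iS; move: iS1; rewrite -E inE qi => /andP[].
Qed.

Lemma admissible_collapse w b ep em o : (1 < #|A|)%N -> admissible S w b ep em o ->
  admissible S' (quotient_weight q S w) (fibre_sum q S b) (fibre_sum q S ep) (fibre_sum q S em)
    (if o is Some x then if x \in A then None else Some x else None).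
Proof.
move=> A1 [w0 ws ep0 em0 [j sm] rt par ct ex].
have qS : {in S, forall x, q x \in S'} by move=> x; apply: collapse_in.
have dE B : B \subset S' -> deg (quotient_weight q S w) S' (fibre_sum q S ep) (fibre_sum q S em) B
   = deg w S ep em (preim_in q S B).
  by move=> BS; rewrite /deg cut_quotient // !vol_fibre_sum.
have zE B : dem (fibre_sum q S b) (fibre_sum q S ep) (fibre_sum q S em) B
   = dem b ep em (preim_in q S B) by rewrite /dem !vol_fibre_sum.
have pre1 x : x \in S -> x \notin A -> preim_in q S [set x] = [set x].
  move=> xS xA; apply/setP => y; rewrite !inE /q /collapse; case: ifP => [yA|yA].
    have [yx|_] := eqVneq y x; first by rewrite -yx yA in xA.
    by have [ax|_] := eqVneq a x; [rewrite -ax aA in xA | rewrite andbF].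
  by case: eqP => [->|]; rewrite ?xS ?andbF.
split.
- move=> x y; rewrite /quotient_weight; case: ifP => // _.
  by do 2! (apply: fibre_sum_ge0 => ?).
- by move=> x y; apply: quotient_weight_sym.
- by move=> x; apply: fibre_sum_ge0.
- by move=> x; apply: fibre_sum_ge0.
- by exists j; rewrite vol_fibre_sum preim_full.
- by rewrite !vol_fibre_sum preim_full.
- by move=> B BS; rewrite dE // zE; apply: par; exact: preim_sub.
- move=> B BS B0 BnS oB; rewrite dE // zE; apply: ct; first exact: preim_sub.
  + case/set0Pn: B0 => x xB; apply/set0Pn; exists x; exact: collapse_preimage.
  + exact: preim_neq.
  move=> x ox; apply/eqP => E; move: oB; rewrite ox.
  case: ifP => [xA _|/negbT xA].
    have qB u : u \in A -> u \in [set x].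
      move=> uA; rewrite -E inE (subsetP AS) //=.
      have : x \in preim_in q S B by rewrite E set11.
      by rewrite inE /q /collapse xA uA => /andP[].
    have /subset_leq_card : A \subset [set x] by apply/subsetP.
    by rewrite cards1; lia.
  move=> /(_ x erefl); apply/negP; rewrite negbK eqEsubset; apply/andP; split.
    by apply/subsetP => u uB; rewrite -E; apply: collapse_preimage.
  have : x \in preim_in q S B by rewrite E set11.
  by rewrite sub1set inE /q /collapse (negbTE xA) => /andP[].
move=> x; case: o ex {ct} => // y ex; case: ifP => // /negbT yA [yx]; subst y.
have [xS [i E] c] := ex x erefl.
have xD : x \in S :\: A by rewrite inE yA.
split; first by rewrite !inE yA xS orbT.
  by exists i; rewrite zE pre1.
by rewrite !fibre_collapse_out // cut_quotient ?pre1 // sub1set !inE yA xS orbT.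
Qed.

End Collapse.

(* Orienting the edges between [A] and [S :\: A] by [g] and contracting [S :\: A] into the root: as [A] is
   tight, the root satisfies [adm_root]. At most half of the edges of the exempt vertex [x] leave [A], as
   otherwise [A :\ x] would violate [adm_cut]. *)
Section Restriction.
Variables (S A : {set V}) (w g : V -> V -> int) (b ep em : V -> int) (o : option V).
Hypotheses (AS : A \subset S) (g_le : forall x y, 0 <= g x y <= w x y).

Let out x := \sum_(y in S :\: A) g x y.
Let inn x := \sum_(y in S :\: A) (w x y - g x y).

Lemma admissible_restrict j : (1 < #|A|)%N -> A != S -> admissible S w b ep em o ->
  deg w S ep em A <= 4 * p%:Z + nrm p (dem b ep em A) ->
  vol out A - vol inn A = vol b A + modulus p * j ->
  admissible A w (fun x => b x - (out x - inn x)) (fun x => ep x + out x)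
    (fun x => em x + inn x) (if o is Some x then if x \in A then Some x else None else None).
Proof.
move=> A1 AnS [w0 ws ep0 em0 [i sm] rt par ct ex] tight bal.
have out0 x : 0 <= out x by apply: sumr_ge0 => y _; have := g_le x y; lia.
have inn0 x : 0 <= inn x by apply: sumr_ge0 => y _; have := g_le x y; lia.
have oi x : out x + inn x = \sum_(y in S :\: A) w x y.
  by rewrite -big_split /=; apply: eq_bigr => y _; ring.
have volD f f' B : vol (fun x => f x + f' x) B = vol f B + vol f' B by rewrite /vol big_split.
have cutE B : B \subset A -> cut w S B = cut w A B + vol out B + vol inn B.
  move=> BA; rewrite -addrA -volD /cut /vol -big_split /=; apply: eq_bigr => x _.
  rewrite oi (big_setID A) /=; congr (_ + _); apply: eq_bigl => y; rewrite !inE.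
    by case yA: (y \in A); rewrite ?andbF // (subsetP AS) // andbT.
  by case yA: (y \in A) => //=; case yB: (y \in B) => //; have := subsetP BA y yB; rewrite yA.
have dE B : B \subset A -> deg w A (fun x => ep x + out x) (fun x => em x + inn x) B = deg w S ep em B.
  by move=> BA; rewrite /deg cutE // !volD; ring.
have zE B : dem (fun x => b x - (out x - inn x)) (fun x => ep x + out x) (fun x => em x + inn x) B
   = dem b ep em B.
  by rewrite /dem /vol -!big_split /= -!sumrB; apply: eq_bigr => x _; ring.
split=> //.
- by move=> x; rewrite addr_ge0.
- by move=> x; rewrite addr_ge0.
- by exists (- j); rewrite /vol !sumrB -/(vol b A) -/(vol out A) -/(vol inn A) bal; ring.
- apply: root_ge; [by apply: vol_ge0 => x; rewrite addr_ge0 | by apply: vol_ge0 => x; rewrite addr_ge0 |].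
  move: tight; rewrite -dE // /deg cut_full add0r => /le_trans; apply.
  rewrite (_ : vol _ _ - vol _ _ = dem b ep em A + modulus p * j) ?nrm_period //.
  by rewrite !volD /dem; lia.
- move=> B BA; rewrite dE // zE; apply: par; exact: subset_trans AS.
- move=> B BA B0 BnA oB; rewrite dE // zE; apply: ct => //; first exact: subset_trans AS.
    by apply: contraNneq AnS => E; rewrite eqEsubset AS -E.
  move=> x ox; apply/eqP => E; move: oB; rewrite ox.
  have -> : x \in A by rewrite -sub1set -E.
  by move=> /(_ x erefl); rewrite E eqxx.
move=> x; case: o ex ct => // y ex ct; case: ifP => // xA [yx]; subst y.
have [xS [k E] c] := ex x erefl; split=> //; first by exists k; rewrite zE.
have sub : A :\ x \subset S := subset_trans (subD1set _ _) AS.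
have [A0 AxS Axx] : [/\ A :\ x != set0, A :\ x != S & A :\ x != [set x]].
  split.
  - by rewrite -card_gt0; have := cardsD1 x A; rewrite xA; lia.
  - by apply/eqP => E1; have := setD11 x A; rewrite E1 xS.
  by apply/eqP => E1; have := setD11 x A; rewrite E1 set11.
have v1 f : vol f A = f x + vol f (A :\ x) by rewrite /vol (big_setD1 x xA).
have := ct _ sub A0 AxS; have -> : nrm p (dem b ep em (A :\ x)) = nrm p (dem b ep em A).
  rewrite -(nrm_period p (dem b ep em (A :\ x)) k) -E dem1; congr nrm.
  by rewrite /dem (v1 b) (v1 ep) (v1 em); ring.
move=> /(_ ltac:(by move=> y [<-])) H.
have := le_trans tight H; rewrite /deg (cut_setD1 ws AS xA).
have := cutE [set x]; rewrite sub1set => /(_ xA); rewrite !vol1 cut1 => ->.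
rewrite (v1 ep) (v1 em); have := ep0 x; have := em0 x; have := out0 x; have := inn0 x.
by rewrite cut1; lia.
Qed.

End Restriction.

(** The orientation of the contracted graph fixes how many edges run each way between [A] and each
    outside vertex. These are distributed over [A], the inside is oriented with them as root edges,
    and the two orientations are glued. *)
Lemma orient_contract S A w b ep em o : admissible S w b ep em o ->
  (forall S' w' b' ep' em' o', (#|S'| < #|S|)%N -> admissible S' w' b' ep' em' o' ->
    orientable p S' w' b') ->
  A \subset S -> (1 < #|A|)%N -> A != S ->
  deg w S ep em A <= 4 * p%:Z + nrm p (dem b ep em A) -> orientable p S w b.
Proof.
move=> ad ih AS A1 AnS tight; have [w0 ws ep0 em0 [i sm] rt par ct ex] := ad.
have /card_gt0P[a aA] : (0 < #|A|)%N by lia.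
have cA : (#|A| < #|S|)%N by rewrite proper_card // properEneq AnS.
have aD : a \notin S :\: A by rewrite inE aA.
have [h1 [h10 h1w h1b]] : orientable p (a |: (S :\: A))
    (quotient_weight (collapse A a) S w) (fibre_sum (collapse A a) S b).
  apply: ih (admissible_collapse AS aA A1 ad).
  by rewrite cardsU1 aD cardsD (setIidPr AS); lia.
have w1a y : y \in S :\: A -> quotient_weight (collapse A a) S w a y = vol (w^~ y) A.
  move=> yD; rewrite /quotient_weight ifN; last by apply: contraNneq aD => ->.
  by rewrite fibre_collapse_in //; apply: eq_bigr => x _; rewrite fibre_collapse_out.
have w1 x y : x \in S :\: A -> y \in S :\: A -> x != y ->
    quotient_weight (collapse A a) S w x y = w x y.
  by move=> xD yD xy; rewrite /quotient_weight (negbTE xy) !fibre_collapse_out.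
(* [g y x] is the number of arcs from [x] in [A] to [y]; the first orientation prescribes only their
   total [h1 a y]. *)
have [g gP] : exists g : V -> V -> int, forall y,
    (forall x, 0 <= g y x <= w x y) /\ (y \in S :\: A -> vol (g y) A = h1 a y).
  apply: (@fin_all_exists _ (fun=> V -> int) (fun y f =>
    (forall x, 0 <= f x <= w x y) /\ (y \in S :\: A -> vol f A = h1 a y))) => y.
  have [yD|yD] := boolP (y \in S :\: A); last first.
    by exists (fun=> 0); split=> // x; rewrite lexx w0.
  have bnd : 0 <= h1 a y <= vol (w^~ y) A.
    rewrite h10 -w1a // -h1w ?setU11 ?setU1r //; last by apply: contraNneq aD => ->.
    by rewrite lerDl h10.
  by have [f f01 fE] := vol_split (fun x => w0 x y) bnd; exists f.
pose out x := \sum_(y in S :\: A) g y x.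
pose inn x := \sum_(y in S :\: A) (w x y - g y x).
have [|j bal] := h1b a; first exact: setU11.
have {}bal : vol out A - vol inn A = vol b A + modulus p * j.
  rewrite -(fibre_collapse_in AS aA b) -bal big_setU1 //= subrr add0r.
  transitivity (\sum_(x in A) \sum_(y in S :\: A) (g y x - (w x y - g y x))).
    by rewrite /vol -sumrB; apply: eq_bigr => x _; rewrite sumrB.
  rewrite exchange_big /=; apply: eq_bigr => y yD.
  have -> : h1 y a = vol (w^~ y) A - h1 a y.
    rewrite -w1a // -h1w ?setU11 ?setU1r //; last by apply: contraNneq aD => ->.
    by ring.
  rewrite -(proj2 (gP y) yD) /vol -!sumrB -?sumrB; apply: eq_bigr => x _; ring.
have g_le x y : 0 <= g y x <= w x y by have [] := gP y.
have [h2 [h20 h2w h2b]] := ih _ _ _ _ _ _ cA (admissible_restrict AS (g := fun x y => g y x) g_le A1 AnS ad tight bal).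
exists (fun x y => if x \in A then (if y \in A then h2 x y else g y x)
                   else (if y \in A then w x y - g x y else h1 x y)).
split.
- move=> x y; case: ifP => _; case: ifP => _ //; first by have := g_le x y; lia.
  by have := g_le y x; rewrite ws; lia.
- move=> x y xS yS xy; case: ifP => xA; case: ifP => yA.
  + exact: h2w.
  + by rewrite (ws y x); ring.
  + by rewrite ws; ring.
  have [xD yD] : x \in S :\: A /\ y \in S :\: A by rewrite !inE xA yA.
  by rewrite h1w ?w1 // !inE ?xA ?yA ?xS ?yS orbT.
move=> x xS; case: (boolP (x \in A)) => xA.
  have [k E] := h2b x xA; exists k; rewrite (big_setID A) /= (setIidPr AS).
  transitivity (\sum_(y in A) (h2 x y - h2 y x) + (out x - inn x)); last by rewrite E; ring.
  congr (_ + _); first by apply: eq_bigr => y ->.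
  rewrite -sumrB; apply: eq_bigr => y; rewrite inE => /andP[/negbTE-> _].
  by rewrite ws.
have xD : x \in S :\: A by rewrite inE xA.
have ax : a != x by apply: contraNneq xA => <-.
have [|k E] := h1b x; first by rewrite setU1r.
exists k; rewrite -(fibre_collapse_out aA b xD) -E (big_setID A) /= (setIidPr AS) big_setU1 //=.
congr (_ + _); last by apply: eq_bigr => y; rewrite inE => /andP[/negbTE-> _].
have -> : h1 x a = vol (w^~ x) A - h1 a x.
  by rewrite -w1a // -h1w ?setU11 ?setU1r //; ring.
rewrite -(proj2 (gP x) xD) /vol -!sumrB; apply: eq_bigr => y yA.
by rewrite yA ws; ring.
Qed.

(** * Vertex sets of size at most two, and the induction *)

Lemma nrm_triangle (y z : int) : nrm p (y + z) <= nrm p y + nrm p z.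
Proof.
have [t [j [-> -> _]]] := nrm_spec p z.
by rewrite addrA nrm_period nrm_add.
Qed.

Lemma orient_pair w b x y (t i j : int) : x != y -> (forall u v, w u v = w v u) ->
  `|t| <= w x y -> (2 %| w x y - t)%Z -> t = b x + modulus p * i ->
  b x + b y = modulus p * j -> orientable p [set x; y] w b.
Proof.
move=> xy ws tw /dvdzP[k E] tb bb.
have yx : (y == x) = false by rewrite eq_sym (negbTE xy).
(* [k] arcs run from [y] to [x] and the others from [x] to [y], a net outflow of [t] at [x]. *)
exists (fun u v => if u == x then w x y - k else k); split.
- by move=> u v; case: ifP => _; lia.
- move=> u v; rewrite !inE => /orP[] /eqP-> /orP[] /eqP->; rewrite ?eqxx ?yx //.
    by move=> _; ring.
  by move=> _; rewrite (ws y); ring.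
move=> u; rewrite !inE => /orP[] /eqP->; rewrite big_setU1 ?inE //= big_set1 eqxx yx.
  by exists i; lia.
by exists (- i - j); lia.
Qed.

Lemma orient_two S w b ep em o : admissible S w b ep em o -> #|S| = 2%N -> orientable p S w b.
Proof.
move=> ad /eqP/cards2P[x [y [xy SE]]]; have [w0 ws ep0 em0 [j sm] rt par ct ex] := ad.
have yx : y != x by rewrite eq_sym.
have vE f : vol f S = f x + f y by rewrite SE /vol big_setU1 ?inE // big_set1.
have cE : cut w S [set x] = w x y /\ cut w S [set y] = w x y.
  have Sx : S :\ x = [set y] by rewrite SE setU1K // inE.
  have Sy : S :\ y = [set x] by rewrite SE setUC setU1K // inE.
  by rewrite !cut1 Sx Sy !big_set1 (ws y x).
case: cE => cx cy; rewrite vE in sm.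
have [xs ys] : [set x] \subset S /\ [set y] \subset S by rewrite SE !sub1set !inE !eqxx orbT.
have parx := par _ xs; rewrite deg1 dem1 cx in parx.
have pary := par _ ys; rewrite deg1 dem1 cy in pary.
case: o ad ct ex => [z|] ad ct ex.
  have [zS [i zi] e] := ex z erefl; rewrite dem1 /modulus in zi.
  have {zS} : z \in [set x; y] by rewrite -SE.
  rewrite SE; case/set2P => zE; subst z.
    rewrite cx in e.
    (* The inner edges are made to balance the root edges at the exempt vertex. *)
    apply: (@orient_pair _ _ _ _ (em x - ep x) (- i) j) => //; rewrite /modulus; lia.
  rewrite cy in e; rewrite setUC.
  by apply: (@orient_pair _ _ _ _ (em y - ep y) (- i) j) => //; rewrite ?(ws y x) /modulus in sm *; lia.
have single u : u \in S -> 4 * p%:Z + nrm p (dem b ep em [set u]) <= deg w S ep em [set u].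
  move=> uS; apply: (adm_cut1 ad uS) => //; apply/eqP => E.
  by have := cards1 u; rewrite E SE cards2 xy.
have := single x; have := single y; rewrite -!sub1set xs ys => /(_ isT) + /(_ isT).
rewrite !deg1 cx cy => Hy Hx.
have := nrm_triangle (dem b ep em [set x]) (dem b ep em [set y]).
rewrite (_ : _ + _ = vol ep S - vol em S + modulus p * j); last by rewrite !dem1 !vE -sm; ring.
rewrite nrm_period => tri.
have := root_le (vol_ge0 S ep0) (vol_ge0 S em0) rt; rewrite !vE in tri *; move=> rl.
(* The two cut conditions are added and compared with the root bound. Below, parity settles the case
   where [t] has absolute value [2p + 1]. *)
have wp : 2 * p%:Z <= w x y by lia.
have [t [i [E nE lt]]] := nrm_spec p (b x); rewrite SE.
apply: (@orient_pair _ _ _ _ t (- i) j) => //; rewrite /modulus in E *; lia.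
Qed.

Lemma orient_small S w b ep em o : admissible S w b ep em o -> (#|S| <= 1)%N -> orientable p S w b.
Proof.
move=> ad S1; have [j sm] := adm_sum ad; exists (fun _ _ => 0); split=> //.
  by move=> x y xS yS; move/card_le1_eqP: S1 => /(_ x y xS yS) ->; rewrite eqxx.
move=> x xS; exists (- j); rewrite big1 //.
have SE : S = [set x] by apply/eqP; rewrite eq_sym eqEcard sub1set xS cards1.
by move: sm; rewrite SE vol1 => ->; ring.
Qed.

(** The outer induction on the number of vertices serves contraction and the removal of an isolated
    vertex, the inner one on [size_of] serves deletion, lifting and exemption. *)
Lemma admissible_orientable S w b ep em o : (0 < p)%N ->
  admissible S w b ep em o -> orientable p S w b.
Proof.
move=> p0; have [n] := ubnP #|S|; elim: n => // n IHn in S w b ep em o *; rewrite ltnS => Sn.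
have ih S' w' b' ep' em' o' : (#|S'| < #|S|)%N -> admissible S' w' b' ep' em' o' ->
    orientable p S' w' b' by move=> lt; apply: IHn; lia.
have [m] := ubnP (absz (size_of S w ep em o)).
elim: m => // m IHm in w b ep em o *; rewrite ltnS => lem ad.
have ih' : smaller_orientable S w ep em o.
  move=> w' b' ep' em' o' ad' lt; apply: (IHm _ _ _ _ _ _ ad').
  suff : 0 <= size_of S w' ep' em' o' by lia.
  have [w0 _ ep0 em0 _ _ _ _ _] := ad'.
  have := vol_ge0 S ep0; have := vol_ge0 S em0.
  have : 0 <= \sum_(x in S) \sum_(y in S) w' x y by do 2! (apply: sumr_ge0 => ? _).
  rewrite /size_of; case: o' {ad' lt}; nia.
have [S1|S1] := leqP #|S| 1; first exact: orient_small ad S1.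
have [S2|S2] := eqVneq #|S| 2%N; first exact: orient_two ad S2.
have S3 : (2 < #|S|)%N by lia.
case: (pickP [pred A : {set V} | [&& A \subset S, (1 < #|A|)%N, A != S &
    deg w S ep em A < 4 * p%:Z + 2 + nrm p (dem b ep em A)]]) => [A /and4P[AS A1 AnS lt]|none].
  apply: (orient_contract ad ih AS A1 AnS).
  (* Degree and [nrm] of the demand have the same parity, so a set without slack satisfies the
     tightness bound. *)
  by have := adm_parity ad AS; have [k E] := nrm_parity p (dem b ep em A); lia.
have sl : slack S w b ep em.
  by move=> A AS A1 AnS; have := none A; rewrite /= AS A1 AnS /= => /negbT; rewrite -leNgt.
case: o ad ih' {lem} => [x|] ad ih'; last exact: orient_tight ad sl ih' S3.
have [c0|c0] := eqVneq (cut w S [set x]) 0.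
  have [xS _ _] := adm_exempt ad erefl.
  apply: (orient_isolated ad c0) => ad'; apply: ih ad'.
  by rewrite [X in (_ < X)%N](cardsD1 x) xS.
exact: (orient_exempt ad sl ih' S3).
Qed.

(* The theorem of Lovasz, Thomassen, Wu and Zhang that 6p-edge-connected graphs are [Z_(2p+1)]-connected. *)
Lemma orientable_edge_connected w b : (0 < p)%N ->
  (forall x y, 0 <= w x y) -> (forall x y, w x y = w y x) ->
  (forall A, (2 %| cut w [set: V] A - vol b A)%Z) -> (exists j, vol b [set: V] = modulus p * j) ->
  (forall A, A != set0 -> A != [set: V] -> 6 * p%:Z <= cut w [set: V] A) ->
  orientable p [set: V] w b.
Proof.
move=> p0 w0 ws par sm ct; have v0 A : vol (fun=> 0) A = 0 by rewrite /vol big1.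
apply: (@admissible_orientable _ _ _ (fun=> 0) (fun=> 0) None) => //; split=> //.
- by rewrite !v0; split; lia.
- by move=> A _; rewrite /deg /dem !v0; have := par A; lia.
(* The distance is at most [2p + 1], and when it equals [2p + 1] the cut is odd, hence larger than
   [6p]. *)
move=> A _ A0 AnS _; have := ct A A0 AnS; have := par A; rewrite /deg /dem !v0 !addr0 ?subr0.
by have := nrm_le p (vol b A); have [k E] := nrm_parity p (vol b A); lia.
Qed.

End Admissible.

(** * Signed graphs *)

Lemma card_sum1 (T : finType) (P : pred T) : #|[set e | P e]|%:Z = \sum_(e | P e) 1.
Proof. by rewrite sumr_const natz cardsE. Qed.

Lemma subset_of_card (T : finType) (A : {set T}) m : (m <= #|A|)%N ->
  exists2 B : {set T}, B \subset A & #|B| = m.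
Proof.
move=> mA; exists [set x in take m (enum A)].
  by apply/subsetP => x; rewrite inE => /mem_take; rewrite mem_enum.
by rewrite cardsE (card_uniqP _) ?take_uniq ?enum_uniq // size_takel // -cardE.
Qed.

Definition sign (c : bool) : int := if c then 1 else -1.

Lemma sum_sign (T : finType) (A B : {set T}) : B \subset A ->
  \sum_(e in A) sign (e \in B) = 2 * #|B|%:Z - #|A|%:Z.
Proof.
move=> BA; rewrite (big_setID B) /= (setIidPr BA).
rewrite (eq_bigr (fun=> 1)) => [|e ->] //.
rewrite [X in _ + X](eq_bigr (fun=> -1)); last by move=> e; rewrite inE => /andP[/negbTE->].
by rewrite !sumr_const mulNrn !natz; have := cardsID B A; rewrite (setIidPr BA); lia.
Qed.

Section Switching.
Variables (V E : finType) (ends : E -> V * V) (neg : E -> bool).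
Hypothesis loopless_ends : loopless ends.
Implicit Types (x y : V) (e : E) (S X : {set V}).

Definition switch_set S e : bool := neg e (+) ((ends e).1 \in S) (+) ((ends e).2 \in S).

Lemma switch_seqE (f : E -> bool) s e : switch_seq ends f s e =
  f e (+) odd (count_mem (ends e).1 s) (+) odd (count_mem (ends e).2 s).
Proof.
elim: s f => [|v s IH] f /=; first by rewrite !addbF.
rewrite [LHS]IH /switch /incident !oddD ![_ == v]eq_sym; have := loopless_ends e.
case: (eqVneq v (ends e).1) => [->|_] ue; first rewrite (negbTE ue).
  by rewrite /=; case: (f e); case: odd; case: odd.
by case: (_ == _); rewrite /=; case: (f e); case: odd; case: odd.
Qed.

Lemma switch_seq_enum S e : switch_seq ends neg (enum S) e = switch_set S e.
Proof. by rewrite switch_seqE !count_uniq_mem ?enum_uniq // !mem_enum !oddb. Qed.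

(** [S] minimises the number of negative edges. Switching further at [X] gives the symmetric
    difference [S2] and exchanges the signs exactly across the cut of [X]. *)
Lemma min_switching : exists S, forall X,
  (#|[set e | switch_set S e && (((ends e).1 \in X) != ((ends e).2 \in X))]| <=
   #|[set e | ~~ switch_set S e && (((ends e).1 \in X) != ((ends e).2 \in X))]|)%N.
Proof.
pose cost S := #|[set e | switch_set S e]|.
case: (@arg_minnP {set V} set0 predT cost isT) => S _ Smin; exists S => X.
pose S2 := (S :\: X) :|: (X :\: S).
have S2E e : switch_set S2 e = switch_set S e (+) (((ends e).1 \in X) != ((ends e).2 \in X)).
  rewrite /switch_set !inE.
  by case: (_ \in S); case: (_ \in S); case: (_ \in X); case: (_ \in X); case: (neg e).
have := Smin S2 isT; rewrite /cost.
pose K := [set e | ((ends e).1 \in X) != ((ends e).2 \in X)].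
rewrite -(cardsID K [set e | switch_set S e]) -[X in (_ <= X)%N](cardsID K).
have -> : [set e | switch_set S2 e] :\: K = [set e | switch_set S e] :\: K.
  by apply/setP => e; rewrite !inE S2E; case: (_ != _); rewrite ?addbF.
have -> : [set e | switch_set S2 e] :&: K = [set e | ~~ switch_set S e & ((ends e).1 \in X) != ((ends e).2 \in X)].
  by apply/setP => e; rewrite !inE S2E; case: (_ != _); rewrite ?addbT ?andbF.
rewrite leq_add2r; congr (_ <= _)%N; apply: eq_card => e; by rewrite !inE.
Qed.

Definition net (tau : E -> bool) (f : E -> bool) x : int :=
  \sum_e ((if (ends e).1 == x then sign (tau e) else 0)
        + (if (ends e).2 == x then (if f e then sign (tau e) else - sign (tau e)) else 0)).

Lemma dplus_dminus f tau x :
  (dplus ends f tau x)%:Z - (dminus ends f tau x)%:Z = net tau f x.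
Proof.
rewrite /dplus /dminus !card_sum1 big_mkcond [X in _ - X]big_mkcond -sumrB; apply: eq_bigr => e _.
rewrite /in_Eplus /in_Eminus /incident; have := loopless_ends e.
have [ux|_] := eqVneq (ends e).1 x; have [vx|_] := eqVneq (ends e).2 x => ue;
  try by case: (f e); case: (tau e).
by rewrite ux vx eqxx in ue.
Qed.

(** [tau] records the direction at the first end. Reversing all half-edges at vertices of [S] turns
    an orientation of the switched graph into one of the original graph. *)
Lemma net_switch S tau x : net (fun e => tau e (+) ((ends e).1 \in S)) neg x =
  (if x \in S then -1 else 1) * net tau (switch_set S) x.
Proof.
rewrite mulr_sumr; apply: eq_bigr => e _; rewrite mulrDr; congr (_ + _).
  by case: eqP => [->|_]; rewrite ?mulr0 //; case: (tau e); case: (x \in S).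
case: eqP => [vx|_]; rewrite ?mulr0 // /switch_set vx.
by case: (tau e); case: (x \in S); case: (neg e); case: (_ \in S).
Qed.

End Switching.

(** * The positive edges as a weighted graph *)

Section Multiplicities.
Variables (V E : finType) (ends : E -> V * V) (sg : E -> bool).

(* [sg] is the set of negative edges after switching; [arcs] and [mult] concern the positive ones. *)
Definition arcs (z : V * V) : {set E} := [set e | ~~ sg e & ends e == z].

Definition mult x y : int := #|arcs (x, y)|%:Z + #|arcs (y, x)|%:Z.

Lemma sum_arcs (X Y : {set V}) : \sum_(x in X) \sum_(y in Y) #|arcs (x, y)|%:Z =
  \sum_(e | [&& ~~ sg e, (ends e).1 \in X & (ends e).2 \in Y]) 1.
Proof.
rewrite pair_big_dep /= [RHS](partition_big ends (fun z => (z.1 \in X) && (z.2 \in Y))) /=; last first.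
  by move=> e /and3P[_ -> ->].
apply: eq_bigr => -[x y] /andP[/= xX yY]; rewrite card_sum1; apply: eq_bigl => e.
by case: (ends e =P (x, y)) => [->|]; rewrite /= ?xX ?yY ?andbT ?andbF.
Qed.

Lemma cut_mult (X : {set V}) : cut mult [set: V] X =
  #|[set e | ~~ sg e && (((ends e).1 \in X) != ((ends e).2 \in X))]|%:Z.
Proof.
rewrite /cut /mult; under eq_bigr do rewrite big_split /=; rewrite big_split /=.
rewrite [X in _ + X]exchange_big /= !sum_arcs card_sum1.
rewrite [X in X + _]big_mkcond [X in _ + X]big_mkcond [RHS]big_mkcond -big_split /=; apply: eq_bigr => e _; rewrite !inE.
by case: (sg e); case: (_ \in X); case: (_ \in X).
Qed.

(** The degree sum over [X] counts the edges of the cut once and those inside [X] twice. *)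
Lemma mult_parity (X : {set V}) :
  (2 %| cut mult [set: V] X - vol (fun x => (\sum_y mult x y)%R) X)%Z.
Proof.
have E1 : vol (fun x => \sum_y mult x y) X =
    cut mult [set: V] X + 2 * \sum_(x in X) \sum_(y in X) #|arcs (x, y)|%:Z.
  have -> : 2 * (\sum_(x in X) \sum_(y in X) #|arcs (x, y)|%:Z) = \sum_(x in X) \sum_(y in X) mult x y.
    rewrite /mult; under [RHS]eq_bigr do rewrite big_split /=; rewrite big_split /=.
    by rewrite [X in _ + X]exchange_big /=; ring.
  rewrite /cut -big_split /=; apply: eq_bigr => x _.
  rewrite [LHS](bigID (mem X)) /= addrC; congr (_ + _).
  by apply: eq_bigl => y; rewrite !inE andbT.
by rewrite E1; lia.
Qed.

Lemma orient_arcs (h : V -> V -> int) : (forall x y, 0 <= h x y) ->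
  (forall x y, x != y -> h x y + h y x = mult x y) ->
  exists tau : E -> bool, forall x,
    \sum_(e | ~~ sg e) ((if (ends e).1 == x then sign (tau e) else 0)
      + (if (ends e).2 == x then - sign (tau e) else 0)) = \sum_y (h x y - h y x).
Proof.
move=> h0 hw.
(* [g x y] of the edges stored as [(x, y)] run from [x] to [y]: edges stored as [(y, x)] are used
   first, and only the excess of [h x y] is taken here. On the diagonal 0 is a default, as the two
   ends cancel. *)
pose g x y : int := if x == y then 0 else Num.max 0 (h x y - #|arcs (y, x)|%:Z).
have [B BP] : exists B : V * V -> {set E}, forall z,
    B z \subset arcs z /\ #|B z|%:Z = g z.1 z.2.
  apply: (@fin_all_exists _ (fun=> {set E}) (fun z C => C \subset arcs z /\ #|C|%:Z = g z.1 z.2)).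
  case=> x y; have [|C CA cC] := @subset_of_card _ (arcs (x, y)) (absz (g x y)).
    rewrite /g; case: eqP => [//|/eqP xy]; have := hw x y xy; have := h0 x y; have := h0 y x.
    rewrite /mult; set c := #|arcs (x, y)|; set d := #|arcs (y, x)|.
    by case: (leP 0 (h x y - d%:Z)); lia.
  by exists C; split=> //=; rewrite cC gez0_abs // /g; case: eqP => // _; rewrite le_max lexx.
exists (fun e => e \in B (ends e)) => x.
have sE z : \sum_(e | ~~ sg e && (ends e == z)) sign (e \in B (ends e)) = 2 * g z.1 z.2 - #|arcs z|%:Z.
  have [BA <-] := BP z; rewrite -sum_sign //; apply: eq_big => e; first by rewrite inE.
  by case/andP=> _ /eqP->.
have out : \sum_(e | ~~ sg e) (if (ends e).1 == x then sign (e \in B (ends e)) else 0)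
    = \sum_y (2 * g x y - #|arcs (x, y)|%:Z).
  rewrite -big_mkcondr (partition_big (fun e => (ends e).2) predT) //=; apply: eq_bigr => y _.
  rewrite -(sE (x, y)); apply: eq_bigl => e; rewrite -andbA; congr (_ && _).
have inn : \sum_(e | ~~ sg e) (if (ends e).2 == x then - sign (e \in B (ends e)) else 0)
    = \sum_y (#|arcs (y, x)|%:Z - 2 * g y x).
  rewrite -big_mkcondr (partition_big (fun e => (ends e).1) predT) //=; apply: eq_bigr => y _.
  rewrite -opprB -(sE (y, x)) sumrN; congr (- _); apply: eq_bigl => e.
  rewrite -andbA; congr (_ && _).
  by case: (ends e) => u v /=; rewrite xpair_eqE andbC.
rewrite big_split /= out inn -big_split /=; apply: eq_bigr => y _; rewrite /g (eq_sym y).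
case: (eqVneq x y) => [->|xy]; first by ring.
have := hw x y xy; rewrite /mult; set c := #|arcs (x, y)|; set d := #|arcs (y, x)|.
by case: (leP 0 (h x y - d%:Z)); case: (leP 0 (h y x - c%:Z)); lia.
Qed.

End Multiplicities.

(** * Residues and the assembly of the orientation *)

Lemma eq_Zp (n : nat) (a : 'Z_n) (c d : nat) (q : int) : (1 < n)%N ->
  c%:Z - d%:Z = (a : nat)%:Z + n%:Z * q -> (c%:R - d%:R : 'Z_n) = a.
Proof.
move=> n1 E; have := congr1 (fun z : int => z%:~R : 'Z_n) E.
rewrite intrB intrD intrM !pmulrn => ->.
by rewrite -[(Posz n)%:~R]/(n%:R) (pchar_Zp n1) mul0r addr0 -pmulrn natr_Zp.
Qed.

(* [(k + 1) ^ 2] is the inverse of 4 modulo [2k + 1]. *)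
Lemma residue_four (k : nat) (z : int) (m : nat) : exists2 i : nat, (i <= 2 * k)%N &
  exists q : int, 4 * i%:Z - 2 * m%:Z = z + (2 * k%:Z + 1) * q.
Proof.
pose n : int := 2 * k%:Z + 1; have n0 : n != 0 by rewrite /n; lia.
pose a := (z + 2 * m%:Z) * (k%:Z + 1) ^+ 2.
have r0 := modz_ge0 a n0; have : (a %% n)%Z < n by rewrite ltz_pmod // /n; lia.
have := divz_eq a n; move: r0; set r := (a %% n)%Z; set t := (a %/ n)%Z => r0 aE rn.
exists (absz r); first by rewrite /n in rn; lia.
(* This comes from [4 (k + 1)^2 = 1 + (2k + 1) (2k + 3)]. *)
exists ((z + 2 * m%:Z) * (2 * k%:Z + 3) - 4 * t).
have -> : (absz r)%:Z = a - t * n by lia.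
by rewrite /a /n; ring.
Qed.

Local Close Scope ring_scope.

Theorem theorem3 (k : nat) (V E : finType) (ends : E -> V * V) (neg : E -> bool) :
  0 < k ->
  loopless ends ->
  unbalanced ends neg (2 * k + 1) ->
  edge_connected ends (12 * k - 1) ->
  forall beta : V -> 'Z_(2 * k + 1),
    exists tau : E -> bool, beta_orientation ends neg beta tau.
Proof.
move=> k0 ll unb conn beta.
have [S Smin] := min_switching ends neg.
pose sg := switch_set ends neg S.
have many : 2 * k + 1 <= #|[set e | sg e]|.
  by have := unb (enum S); under eq_finset do rewrite switch_seq_enum //.
(* At least half of the [12k - 1] or more edges of a cut are positive, which is [6k] after rounding
   up. *)
have posconn X : X != set0 -> X != setT -> (6 * k%:Z <= cut (mult ends sg) [set: V] X)%R.
  move=> X0 XT; rewrite cut_mult.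
  have := Smin X; have := conn X X0 XT; rewrite -/sg.
  have -> : #|[set e | ((ends e).1 \in X) != ((ends e).2 \in X)]| =
     #|[set e | sg e && (((ends e).1 \in X) != ((ends e).2 \in X))]|
   + #|[set e | ~~ sg e && (((ends e).1 \in X) != ((ends e).2 \in X))]|.
    rewrite -(cardsID [set e | sg e]); congr (_ + _); apply: eq_card => e; rewrite !inE //.
    by rewrite andbC.
  by lia.
(* By [net_switch], the demands at vertices of [S] have to be negated for the switched graph. *)
pose s x : int := (if x \in S then -1 else 1)%R.
pose Z : int := (\sum_x s x * (beta x : nat)%:Z)%R.
(* With [i] sink edges among [m] negative ones, the negative edges contribute
   [2i - 2(m - i) = 4i - 2m] in total, which has to match [Z] modulo [2k + 1]. As [i] is at most
   [2k], there are enough negative edges. *)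
have [i ik [q iq]] := residue_four k Z #|[set e | sg e]|.
have [|T TN cT] := @subset_of_card _ [set e | sg e] i; first by lia.
pose nu x : int := (\sum_(e | sg e) ((if (ends e).1 == x then sign (e \in T) else 0)
  + (if (ends e).2 == x then sign (e \in T) else 0)))%R.
have sum_at u (c : int) : (\sum_(x : V) (if u == x then c else 0) = c)%R.
  by rewrite -big_mkcond (big_pred1 u) // => x; rewrite eq_sym.
have sum_nu : (\sum_x nu x = Z + (2 * k%:Z + 1) * q)%R.
  rewrite /nu exchange_big /= -iq.
  have -> : (4 * i%:Z - 2 * #|[set e | sg e]|%:Z = 2 * (2 * i%:Z - #|[set e | sg e]|%:Z))%R by ring.
  rewrite -cT -sum_sign // big_distrr /=; apply: eq_big => e; first by rewrite inE.
  by move=> _; rewrite big_split /= !sum_at; ring.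
pose d x : int := (\sum_y mult ends sg x y)%R.
pose r x : int := (s x * (beta x : nat)%:Z - nu x)%R.
(* The odd number [2k + 1] is added to the residual demand [r x] when its parity differs from that
   of the positive degree [d x]. *)
pose b x : int := (r x + (2 * k%:Z + 1) * ((r x - d x)%R %% 2)%Z)%R.
have b_parity X : (2 %| (cut (mult ends sg) [set: V] X - vol b X)%R)%Z.
  suff : (2 %| (vol d X - vol b X)%R)%Z by have := mult_parity ends sg X; rewrite -/d; lia.
  rewrite /vol -sumrB; elim/big_rec: _ => [|x t _]; rewrite ?dvdz0 // /b => ht.
  have := divz_eq (r x - d x) 2; set u := (_ %/ _)%Z; set v := (_ %% _)%Z => rd.
  have -> : (d x - (r x + (2 * k%:Z + 1) * v) + t = - (2 * (u + v + k%:Z * v)) + t)%R by lia.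
  by lia.
have sum_b : exists j, vol b [set: V] = (modulus k * j)%R.
  pose t : int := (\sum_x ((r x - d x)%R %% 2)%Z - q)%R.
  have bt : (vol b [set: V] = (2 * k%:Z + 1) * t)%R.
    have -> : (vol b [set: V] = \sum_x b x)%R by apply: eq_bigl => x; rewrite inE.
    by rewrite big_split /= -mulr_sumr sumrB sum_nu /t /Z; ring.
  (* The total is a multiple of [2k + 1], and it is even since the cut of the whole vertex set is
     empty. *)
  have := b_parity [set: V]; rewrite cut_full bt => /dvdzP[c ct].
  by exists (- c - k%:Z * t)%R; rewrite /modulus; lia.
have w0 x y : (0 <= mult ends sg x y)%R by [].
have ws x y : mult ends sg x y = mult ends sg y x by rewrite /mult addrC.
have [h [h0 hw hb]] := orientable_edge_connected k0 w0 ws b_parity sum_b posconn.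
have [tau1 tau1E] := orient_arcs h0 (fun x y => hw x y (in_setT x) (in_setT y)).
pose tau e := if sg e then e \in T else tau1 e.
exists (fun e => tau e (+) ((ends e).1 \in S)) => x.
have [j Ej] := hb x (in_setT x).
have netE : (net ends tau sg x = nu x + b x + modulus k * j)%R.
  rewrite -addrA -Ej (_ : \sum_(y in [set: V]) _ = \sum_y (h x y - h y x))%R; last first.
    by apply: eq_bigl => y; rewrite inE.
  rewrite -tau1E /net (bigID sg) /=; congr (_ + _)%R; apply: eq_bigr => e; rewrite /tau.
    by move=> ->.
  by move=> /negbTE->.
have s2 : (s x * s x = 1)%R by rewrite /s; case: ifP.
apply: (eq_Zp (q := s x * (((r x - d x)%R %% 2)%Z + 2 * j))%R); first by lia.
rewrite dplus_dminus // net_switch netE /b /r /modulus -/(s x).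
transitivity (s x * s x * (beta x : nat)%:Z + (2 * k + 1)%N%:Z * (s x * (((r x - d x)%R %% 2)%Z + 2 * j)))%R.
  rewrite PoszD PoszM; ring.
by rewrite s2 mul1r.
Qed.
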